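(* (In ZFC) There exists a hereditary interval algebra of cardinality $\aleph_1$.
   Context: An interval algebra is a Boolean algebra isomorphic to the algebra of finite unions of half-open intervals of some linearly ordered set. An interval algebra is hereditary if every one of its subalgebras is an interval algebra. *)

(* Defs.v *)
From HB Require Import structures.
From mathcomp Require Import all_boot all_order interval.
From mathcomp Require Import boolp classical_sets functions cardinality.

Set Implicit Arguments.
Unset Strict Implicit.
Unset Printing Implicit Defensive.

Import Order.Theory.
Local Open Scope classical_set_scope.
Local Open Scope order_scope.

(* Boolean algebras are the library's ctbDistrLatticeType (complemented
   bounded distributive lattices). *)

Record subalgebra d (B : ctbDistrLatticeType d) := Subalgebra {
  subalgebra_pred :> {pred B};
  subalgebra0 : \bot \in subalgebra_pred;
  subalgebra1 : \top \in subalgebra_pred;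
  subalgebraI :
    {in subalgebra_pred &, forall x y, x `&` y \in subalgebra_pred};
  subalgebraU :
    {in subalgebra_pred &, forall x y, x `|` y \in subalgebra_pred};
  subalgebraC :
    {in subalgebra_pred, forall x, ~` x \in subalgebra_pred}
}.

(* A subalgebra as a Boolean algebra in its own right: the operations are
   those of B, so that subalgebra_val is an injective homomorphism. *)
Section SubalgebraType.
Context d (B : ctbDistrLatticeType d) (S : subalgebra B).

HB.instance Definition _ := Order.isTBLatticeClosed.Build d B
  (subalgebra_pred S) (@subalgebraI _ _ S) (@subalgebraU _ _ S)
  (subalgebra0 S) (subalgebra1 S).

Record subalgebra_type := SubalgebraElt {
  subalgebra_val :> B;
  subalgebra_valP : subalgebra_val \in subalgebra_pred S
}.

HB.instance Definition _ := [isSub for subalgebra_val].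
HB.instance Definition _ := [Choice of subalgebra_type by <:].
HB.instance Definition _ :=
  [SubChoice_isTBSubLattice of subalgebra_type by <: with d].

Lemma subalgebra_valI : {morph subalgebra_val : x y / x `&` y}.
Proof. by []. Qed.

Lemma subalgebra_valU : {morph subalgebra_val : x y / x `|` y}.
Proof. by []. Qed.

Lemma subalgebra_val0 : subalgebra_val \bot = \bot.
Proof. by []. Qed.

Lemma subalgebra_val1 : subalgebra_val \top = \top.
Proof. by []. Qed.

Fact subalgebra_meetUl :
  @left_distributive subalgebra_type subalgebra_type Order.meet Order.join.
Proof. by move=> x y z; apply: val_inj; apply: meetUl. Qed.

HB.instance Definition _ :=
  Order.Lattice_Meet_isDistrLattice.Build d subalgebra_type subalgebra_meetUl.

Definition subalgebra_compl (x : subalgebra_type) : subalgebra_type :=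
  SubalgebraElt (subalgebraC (subalgebra_valP x)).

Fact subalgebra_joinxC (x : subalgebra_type) :
  x `|` subalgebra_compl x = \top.
Proof. by apply: val_inj; apply: joinxC. Qed.

Fact subalgebra_meetxC (x : subalgebra_type) :
  x `&` subalgebra_compl x = \bot.
Proof. by apply: val_inj; apply: meetxC. Qed.

HB.instance Definition _ := Order.TBDistrLattice_hasComplement.Build d
  subalgebra_type subalgebra_joinxC subalgebra_meetxC.

Lemma subalgebra_valC : {morph subalgebra_val : x / ~` x}.
Proof. by []. Qed.

End SubalgebraType.

(* Infinite endpoints are needed for the finite unions to form an algebra
   containing the whole of L.  When L has a least element a0, the interval
   ]-oo, b[ is [a0, b[, and one recovers the convention of intervals [a, b[
   with a < b <= +oo; adding a least element to an L that lacks one does not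
   change the algebra up to isomorphism. *)
Inductive half_open_interval d (L : orderType d) : interval L -> Prop :=
| HalfOpenCO (a b : L) : half_open_interval `[a, b[
| HalfOpenNyO (b : L) : half_open_interval `]-oo, b[
| HalfOpenCy (a : L) : half_open_interval `[a, +oo[
| HalfOpenNyy : half_open_interval `]-oo, +oo[.

Definition finite_union_intervals d (L : orderType d) : set (set L) :=
  [set A | exists2 s : seq (interval L),
     (forall i, i \in s -> half_open_interval i) &
     A = (\big[setU/set0]_(i <- s) [set` i])%classic].

Definition is_interval_algebra d (B : ctbDistrLatticeType d) : Prop :=
  exists (d' : Order.disp_t) (L : orderType d') (f : B -> set L),
    [/\ set_bij [set: B] (@finite_union_intervals d' L) f,
        f \bot = set0 /\ f \top = setT,
        forall x y, f (x `&` y) = (f x `&` f y)%classic,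
        forall x y, f (x `|` y) = (f x `|` f y)%classic
      & forall x, f (~` x) = (~` f x)%classic].

Definition is_hereditary d (B : ctbDistrLatticeType d) : Prop :=
  forall S : subalgebra B, is_interval_algebra (subalgebra_type S).

(* aleph_1 is the least uncountable cardinal. *)
Definition has_card_aleph1 T (A : set T) : Prop :=
  ~ countable A /\
  forall (U : Type) (C : set U), ~ countable C -> (A #<= C)%card.

(* Main.v *)
(**
Let L be a set of aleph_1 reals (points of the Cantor space, ordered
lexicographically) that is a lambda'-set: for every countable set P of reals,
L \ P is covered by countably many closed sets disjoint from P. The lower halves
of a Hausdorff gap form such a set. Every subalgebra S of the interval algebra
B(L) is generated by a chain, hence is an interval algebra.

To see this, let S0 be the countable subalgebra of the elements of S whose
boundary points lie in a countable elementary hull. Modulo S0, every element of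
S is a combination of irreducible elements, whose new boundary points form one
finite fibre of the projection from the Cantor space to the Stone space of S0;
elements with the same fibre agree modulo S0. Irreducible elements of the same
type (a countable amount of information) form a chain. The places where such a
chain is not compatible with the topology of the Stone space of S0 are countably
many; avoiding them by means of the lambda'-property splits each chain into
countably many pieces concentrated on compact sets. Finally, countably many such
chains can be merged into one, by ordering finer and finer finite partitions in
S0 so that each piece respects the first chain that still splits it.
*)
From HB Require Import structures.
Require Import Defs.
From mathcomp Require Import all_boot all_order interval.
From mathcomp Require Import boolp classical_sets functions cardinality.
From mathcomp Require wochoice.
Set Implicit Arguments.
Unset Strict Implicit.
Unset Printing Implicit Defensive.
Import Order.Theory.

(** * Boolean algebras generated by a chain *)

(** The hull is there for approximation: an extreme coordinate within a type is itself old, so a new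
    boundary point can be approached from both sides by core sets of the same type. The difficulty
    lies in merging the chains. A partition into core sets may cut across the sets of a chain, which
    are then no longer comparable with initial segments of the partition. The merging therefore asks
    that, for each core set s, finitely many core sets comparable with the whole chain decide s
    wherever a member of the chain splits one of their atoms. Fine points are those where this holds
    locally, and compactness passes from local to global; hence the restriction to closed sets of
    fine points. Compactness also gives a single core set that separates an irreducible set from a
    whole chain. A Hausdorff gap provides the closed sets because no real fills it: a countable P
    fails to fill it already at one stage w, while the reals that fit between the two halves at w,
    up to finitely many bits, form a countable union of closed sets containing all lower halves from
    w on. *)

Definition bset (T : Type) := T -> bool.
HB.instance Definition _ T := gen_eqMixin (bset T).
HB.instance Definition _ T := gen_choiceMixin (bset T).

Section BoolSets.
Variable T : Type.
Implicit Types a b c : bset T.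

Definition bset0 : bset T := fun=> false.
Definition bsetT : bset T := fun=> true.
Definition bsetC a : bset T := fun z => ~~ a z.
Definition bsetI a b : bset T := fun z => a z && b z.
Definition bsetU a b : bset T := fun z => a z || b z.

Lemma bsetP a b : a =1 b -> a = b.
Proof. by move=> ab; apply: funext. Qed.

Lemma bset_meetUl : left_distributive bsetI bsetU.
Proof. by move=> a b c; apply: bsetP => z; exact: andb_orl. Qed.

Lemma bset_joinKI b a : bsetI a (bsetU a b) = a.
Proof. by apply: bsetP => z; rewrite /bsetI /bsetU; case: (a z). Qed.

Lemma bset_meetKU b a : bsetU a (bsetI a b) = a.
Proof. by apply: bsetP => z; rewrite /bsetI /bsetU; case: (a z). Qed.

HB.instance Definition _ := @Order.isMeetJoinDistrLattice.Build
  (Order.Disp tt tt) (bset T) (fun a b => bsetI a b == a)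
  (fun a b => (b != a) && (bsetI a b == a)) bsetI bsetU
  (fun _ _ => erefl) (fun _ _ => erefl)
  (fun a b => bsetP (fun z => andbC (a z) (b z)))
  (fun a b => bsetP (fun z => orbC (a z) (b z)))
  (fun a b c => bsetP (fun z => andbA (a z) (b z) (c z)))
  (fun a b c => bsetP (fun z => orbA (a z) (b z) (c z)))
  bset_joinKI bset_meetKU
  bset_meetUl (fun a => bsetP (fun z => andbb (a z))).

Lemma bset_le0x a : (bset0 <= a)%O.
Proof. by apply/eqP/bsetP. Qed.

Lemma bset_lex1 a : (a <= bsetT)%O.
Proof. by apply/eqP/bsetP => z; exact: andbT. Qed.

HB.instance Definition _ :=
  Order.hasBottom.Build (Order.Disp tt tt) (bset T) bset_le0x.
HB.instance Definition _ :=
  Order.hasTop.Build (Order.Disp tt tt) (bset T) bset_lex1.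
HB.instance Definition _ := Order.TBDistrLattice_hasComplement.Build
  (Order.Disp tt tt) (bset T)
  (fun a => bsetP (fun z => orbN (a z)))
  (fun a => bsetP (fun z => andbN (a z))).

End BoolSets.

Section Chains.
Variable T : Type.
Implicit Types a b c : bset T.

Definition subb a b := forall z, a z -> b z.

Definition is_chain (C : bset T -> Prop) :=
  forall a b, C a -> C b -> subb a b \/ subb b a.

Inductive gen (C : bset T -> Prop) : bset T -> Prop :=
| gen_in c : C c -> gen C c
| gen_0 : gen C (@bset0 T)
| gen_C a : gen C a -> gen C (bsetC a)
| gen_I a b : gen C a -> gen C b -> gen C (bsetI a b).

Lemma gen_U C a b : gen C a -> gen C b -> gen C (bsetU a b).
Proof.
move=> ga gb.
suff -> : bsetU a b = bsetC (bsetI (bsetC a) (bsetC b)).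
  by apply/gen_C/gen_I; apply: gen_C.
by apply: bsetP => z; rewrite /bsetU /bsetC /bsetI negb_and !negbK.
Qed.

Lemma subb_anti a b : subb a b -> subb b a -> a = b.
Proof. by move=> ab ba; apply: bsetP => z; apply/idP/idP => [/ab|/ba]. Qed.

Lemma subb_refl a : subb a a. Proof. by []. Qed.
Hint Resolve subb_refl : core.

Lemma subb_trans b a c : subb a b -> subb b c -> subb a c.
Proof. by move=> ab bc z /ab/bc. Qed.

Lemma not_subb a b : ~ subb a b -> exists2 z, a z & ~~ b z.
Proof. by move=> /existsNP[z /not_implyP[az /negP bz]]; exists z. Qed.

End Chains.
#[export] Hint Resolve subb_refl : core.

(** * The algebra of finite unions of half-open intervals *)

Section FiniteUnions.
Context d (L : orderType d).
Implicit Types (A B : set L) (o p : option L).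
Local Open Scope order_scope.
Local Open Scope classical_set_scope.

Definition half_open o p : set L :=
  [set l | (if o is Some a then a <= l else true) &&
           (if p is Some b then l < b else true)].

Lemma half_open_fu o p : finite_union_intervals (half_open o p).
Proof.
have H i : half_open_interval i -> half_open o p = [set` i] ->
    finite_union_intervals (half_open o p).
  move=> hi E; exists [:: i]; last by rewrite big_seq1.
  by move=> j; rewrite inE => /eqP ->.
case: o p H => [a|] [b|] H; [apply: (H _ (HalfOpenCO a b))
  |apply: (H _ (HalfOpenCy a))|apply: (H _ (HalfOpenNyO b))
  |apply: (H _ (HalfOpenNyy L))]; apply/seteqP; split=> l /=;
  by rewrite /half_open /= in_itv /= ?andbT.
Qed.

Lemma half_open_intervalP i : half_open_interval i ->
  exists o p, [set` i] = half_open o p.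
Proof.
case=> [a b|b|a|]; [exists (Some a), (Some b)|exists None, (Some b)
  |exists (Some a), None|exists None, None];
  by apply/seteqP; split=> l; rewrite /half_open /= in_itv /= ?andbT.
Qed.

Lemma fuU A B : finite_union_intervals A -> finite_union_intervals B ->
  finite_union_intervals (A `|` B).
Proof.
move=> [s hs ->] [t ht ->]; exists (s ++ t); last by rewrite big_cat.
by move=> i; rewrite mem_cat => /orP[/hs|/ht].
Qed.

Lemma fu0 : finite_union_intervals (@set0 L).
Proof. by exists [::]; rewrite ?big_nil. Qed.

Lemma half_openI o p o' p' :
  exists q q', half_open o p `&` half_open o' p' = half_open q q'.
Proof.
pose q := if o is Some a then Some (if o' is Some b then Order.max a b else a)
  else o'.
pose q' := if p is Some a then Some (if p' is Some b then Order.min a b else a)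
  else p'.
pose h o p l := (if o is Some a then a <= l else true) &&
  (if p is Some b then l < b else true).
have E l : h o p l && h o' p' l = h q q' l.
  rewrite /h /q /q'; case: o o' p p' {q q'} => [a|] [b|] [c|] [e|] //=;
  by rewrite ?ge_max ?lt_min ?andbT //; do ?case: (_ <= _); do ?case: (_ < _).
exists q, q'; apply/seteqP; split=> l.
  by move=> [h1 h2]; have := E l; rewrite [h o p l]h1 [h o' p' l]h2 => /esym.
by move=> hl; have := E l; rewrite [h q q' l]hl => /andP.
Qed.

Lemma fu_ind (P : set L -> Prop) : P set0 ->
  (forall o p A, P A -> P (half_open o p `|` A)) ->
  forall A, finite_union_intervals A -> P A.
Proof.
move=> P0 PU A [s + ->]; elim: s => [|i s IH] hs; first by rewrite big_nil.
have [|o [p E]] := half_open_intervalP (hs i _); first by rewrite inE eqxx.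
by rewrite big_cons E; apply/PU/IH => j js; apply: hs; rewrite inE js orbT.
Qed.

Lemma fuI A B : finite_union_intervals A -> finite_union_intervals B ->
  finite_union_intervals (A `&` B).
Proof.
move=> fA fB; move: A fA; apply: fu_ind => [|o p A IH].
  by rewrite set0I; exact: fu0.
rewrite setIUl; apply: fuU => //; move: B fB {IH}; apply: fu_ind => [|o' p' B IH].
  by rewrite setI0; exact: fu0.
rewrite setIUr; apply: fuU => //.
by have [q [q' ->]] := half_openI o p o' p'; exact: half_open_fu.
Qed.

Lemma fuC A : finite_union_intervals A -> finite_union_intervals (~` A).
Proof.
move: A; apply: fu_ind => [|o p A IH].
  rewrite setC0; suff -> : [set: L] = half_open None None by exact: half_open_fu.
  by apply/seteqP; split.
rewrite setCU; apply: fuI => //.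
have -> : ~` half_open o p =
    (if o is Some a then half_open None (Some a) else set0) `|`
    (if p is Some b then half_open (Some b) None else set0).
  apply/seteqP; split=> l; rewrite /half_open /=.
    move=> /negP; rewrite negb_and => /orP[].
      by case: o => [a|] //=; rewrite -ltNge; left.
    by case: p => [b|] //=; rewrite -leNgt => ?; right; rewrite /= andbT.
  case: o p => [a|] [b|] //= []//=; rewrite ?andbT => h; apply/negP;
    by rewrite ?andbT ?negb_and -?ltNge -?leNgt h ?orbT.
by apply: fuU; [case: o|case: p] => // *; try exact: half_open_fu; exact: fu0.
Qed.

End FiniteUnions.

Section CutOrder.
Variables (T : Type) (C : bset T -> Prop) (hC : is_chain C).

(** A difference of cuts k minus l will play the interval [l, k[. The empty set serves as least
    endpoint; the full set is excluded because no such interval starts there. *)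
Definition cut_pred : pred (bset T) :=
  fun c => `[< (C c \/ c = @bset0 T) /\ exists z, ~~ c z >].

Definition cut := {c : bset T | cut_pred c}.
(** The chain hypothesis is a parameter of the type so that the order instance, whose totality rests
    on it, can be attached to the type. *)
Definition cut_of (_ : is_chain C) := cut.
HB.instance Definition _ := Choice.on (cut_of hC).

Definition cut_le (u v : cut_of hC) := `[< subb (val u) (val v) >].

Fact cut_le_anti : antisymmetric cut_le.
Proof.
by move=> u v /andP[/asboolP uv /asboolP vu]; apply/val_inj/subb_anti.
Qed.

Fact cut_le_trans : transitive cut_le.
Proof.
by move=> v u w /asboolP uv /asboolP vw; apply/asboolP/(subb_trans uv vw).
Qed.

Fact cut_le_total : total cut_le.
Proof.
move=> [u hu] [v hv]; rewrite /cut_le /=.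
have [[Cu|->] _] := asboolP _ hu; last by apply/orP; left; apply/asboolP.
have [[Cv|->] _] := asboolP _ hv; last by apply/orP; right; apply/asboolP.
by apply/orP; have [|] := hC Cu Cv; [left|right]; apply/asboolP.
Qed.

HB.instance Definition _ := @Order.isOrder.Build (Order.Disp tt tt)
  (cut_of hC) cut_le (fun u v => (v != u) && cut_le u v)
  (fun u v => if (v != u) && cut_le u v then u else v)
  (fun u v => if (v != u) && cut_le u v then v else u)
  (fun _ _ => erefl) (fun _ _ => erefl) (fun _ _ => erefl)
  cut_le_anti cut_le_trans cut_le_total.

Lemma cut_leE (u v : cut_of hC) : (u <= v)%O = `[< subb (val u) (val v) >].
Proof. by []. Qed.

Lemma cut_ltP (u v : cut_of hC) :
  reflect (exists2 z, val v z & ~~ val u z) (u < v)%O.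
Proof.
rewrite ltNge cut_leE; apply: (iffP idP) => [/asboolP/not_subb//|[z vz uz]].
by apply/asboolP => /(_ z vz); rewrite (negbTE uz).
Qed.

End CutOrder.

Section ChainAlgebra.
Variables (T : Type) (C : bset T -> Prop) (hC : is_chain C).
Implicit Types (a b u v : bset T) (l : cut_of hC).

Let CT v := C v \/ v = @bsetT T.
Let C0 v := C v \/ v = @bset0 T.

Lemma chainT_total u v : CT u -> CT v -> subb u v \/ subb v u.
Proof.
move=> [Cu|->]; last by right.
by move=> [Cv|->]; [exact: hC|left].
Qed.

Lemma chain0_total u v : C0 u -> C0 v -> subb u v \/ subb v u.
Proof.
move=> [Cu|->]; last by left.
by move=> [Cv|->]; [exact: hC|right].
Qed.

(* [germ a l]: the set [a] contains a right neighbourhood of the cut [l]. *)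
Definition germ a l := exists v, [/\ C v \/ v = @bsetT T,
  exists z, v z && ~~ val l z & forall z, v z -> ~~ val l z -> a z].

Lemma germI a b l : germ (bsetI a b) l <-> germ a l /\ germ b l.
Proof.
split=> [[v [Cv nv h]]|[[v [Cv nv h]] [w [Cw nw h']]]].
  by split; exists v; split=> // z vz lz; have /andP[] := h z vz lz.
have [vw|wv] := chainT_total Cv Cw; [exists v|exists w]; split=> // z z1 z2.
  by rewrite /bsetI h ?h' //; exact: vw.
by rewrite /bsetI h ?h' //; exact: wv.
Qed.

Lemma germN a l : germ a l -> germ (bsetC a) l -> False.
Proof.
move=> ga gb; have /germI[v [_ [z /andP[vz lz]] h]] := conj ga gb.
by have := h z vz lz; rewrite /bsetI /bsetC andbN.
Qed.

(** With [germI] and [germN], this says that the germs at a cut form an ultrafilter of the generated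
    algebra. *)
Lemma germ_dichotomy a l : gen C a -> germ a l \/ germ (bsetC a) l.
Proof.
have lT : exists z, ~~ val l z by have /asboolP[] := valP l.
elim=> {a} [c Cc||a _ IH|a b _ IHa _ IHb].
- have [cl|/not_subb[z cz lz]] := pselect (subb c (val l)).
    right; exists (@bsetT T); split; [by right|by []|move=> z _].
    by apply: contra => /cl.
  by left; exists c; split; [left|exists z; rewrite cz|].
- by right; exists (@bsetT T); split; [right|by []|].
- case: IH => h; [right|left] => //.
  by move: h => [v [cv nv h]]; exists v; split=> // z h1 h2; rewrite /bsetC negbK h.
- case: IHa => [ga|[v [? ? h]]].
    case: IHb => [gb|[v [? ? h]]]; first by left; apply/germI.
    right; exists v; split=> // z vz lz.
    by rewrite /bsetC /bsetI negb_and -/(bsetC b z) h ?orbT.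
  right; exists v; split=> // z vz lz.
  by rewrite /bsetC /bsetI negb_and -/(bsetC a z) h.
Qed.

Lemma germC a l : gen C a -> germ (bsetC a) l <-> ~ germ a l.
Proof.
move=> ga; split=> [h h'|h]; first exact: germN h' h.
by case: (germ_dichotomy l ga).
Qed.

Lemma gen_local a z : gen C a -> exists u v,
  [/\ C0 u, CT v, v z && ~~ u z &
      forall w, v w -> ~~ u w -> a w = a z].
Proof.
elim=> {a} [c Cc||a _ [u [v [hu hv vuz h]]]|a b _ [u [v [hu hv vuz h]]]
  _ [u' [v' [hu' hv' vuz' h']]]].
- case cz: (c z).
    by exists (@bset0 T), c; split; [right|left|rewrite cz|move=> w].
  exists c, (@bsetT T); split; [by left|by right|by rewrite /bsetT cz|].
  by move=> w _ /negbTE.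
- by exists (@bset0 T), (@bsetT T); split; [right|right|..].
- by exists u, v; split=> // w vw uw; rewrite /bsetC h.
- have [U [CU [uU uU' zU]]] : exists U, C0 U /\ [/\ subb u U, subb u' U & ~~ U z].
    move: vuz vuz' => /andP[_ uz] /andP[_ uz'].
    by have [s|s] := chain0_total hu hu'; [exists u'|exists u]; split.
  have [V [CV [uV uV' zV]]] : exists V, CT V /\ [/\ subb V v, subb V v' & V z].
    move: vuz vuz' => /andP[vz _] /andP[vz' _].
    by have [s|s] := chainT_total hv hv'; [exists v|exists v']; split.
  exists U, V; split; rewrite ?zU ?zV // => w Vw Uw.
  rewrite /bsetI h ?h' //; [exact: uV'|by apply: contra Uw => /uU'
    |exact: uV|by apply: contra Uw => /uU].
Qed.

Lemma germ_nonempty a z : gen C a -> a z -> exists l, germ a l.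
Proof.
move=> ga az; have [u [v [hu hv /andP[vz uz] h]]] := gen_local z ga.
have pu : cut_pred C u by apply/asboolP; split=> //; exists z.
exists (Sub u pu : cut_of hC), v; split=> //=; first by exists z; rewrite vz.
by move=> w vw uw; rewrite h.
Qed.

Lemma germ_cut l k : germ (val k) l <-> (l < k)%O.
Proof.
split=> [[v [_ [z /andP[vz lz]] h]]|/cut_ltP[z kz lz]].
  by apply/cut_ltP; exists z; rewrite ?h.
exists (val k); split=> //; last by exists z; rewrite kz.
by have /asboolP[[Ck|k0] _] := valP k; [left|move: kz; rewrite k0].
Qed.

Lemma germ_fu a : gen C a -> finite_union_intervals [set l | germ a l]%classic.
Proof.
move=> ga; elim: (ga) => {a ga} [c Cc||a ga IH|a b _ IHa _ IHb].
- have [[z cz]|cT] := pselect (exists z, ~~ c z).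
    have pc : cut_pred C c by apply/asboolP; split; [left|exists z].
    rewrite (_ : mkset _ = half_open None (Some (Sub c pc : cut_of hC))).
      exact: half_open_fu.
    apply/seteqP; split=> l /=.
      by move=> /(germ_cut l (Sub c pc : cut_of hC)).
    by move=> lc; apply/(germ_cut l (Sub c pc : cut_of hC)).
  rewrite (_ : mkset _ = half_open None None); first exact: half_open_fu.
  apply/seteqP; split=> l //= _.
  have /asboolP[_ [z lz]] := valP l; exists c; split; first by left.
    by exists z; rewrite lz andbT; apply/negP => cz; apply: cT; exists z; apply/negP.
  by move=> w _ _; apply/negP => cw; apply: cT; exists w; apply/negP.
- rewrite (_ : mkset _ = set0); first exact: fu0.
  by apply/seteqP; split=> // l [v [_ [z /andP[vz lz]] /(_ z vz lz)]].
- rewrite (_ : mkset _ = ~` [set l | germ a l])%classic; first exact: fuC.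
  by apply/seteqP; split=> l /= /germC; apply.
- rewrite (_ : mkset _ = [set l | germ a l] `&` [set l | germ b l])%classic.
    exact: fuI.
  by apply/seteqP; split=> l /= /germI.
Qed.

End ChainAlgebra.

(** The isomorphism sends x to the set of cuts at which f x has a germ; by [germ_cut] the members of
    the chain go to the initial segments. *)
Lemma chain_interval_algebra d (A : ctbDistrLatticeType d) T (f : A -> bset T)
    (C : bset T -> Prop) :
  injective f ->
  (forall x y, f (x `&` y)%O = bsetI (f x) (f y)) ->
  (forall x, f (~` x)%O = bsetC (f x)) ->
  is_chain C -> (forall c, C c -> exists x, f x = c) ->
  (forall x, gen C (f x)) -> is_interval_algebra A.
Proof.
move=> finj fI fC hC Cf fgen.
have f0 : f \bot%O = @bset0 T.
  rewrite -(meetxC \bot%O) fI fC; apply: bsetP => z.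
  by rewrite /bsetI /bsetC andbN.
have fU x y : f (x `|` y)%O = bsetU (f x) (f y).
  rewrite -[(x `|` y)%O]complK complU fC fI !fC; apply: bsetP => z.
  by rewrite /bsetI /bsetC /bsetU negb_and !negbK.
pose g x : set (cut_of hC) := [set l | germ (f x) l]%classic.
have gI x y : g (x `&` y)%O = (g x `&` g y)%classic.
  by apply/seteqP; split=> l; rewrite /g /= fI; move/germI.
have gC x : g (~` x)%O = (~` g x)%classic.
  by apply/seteqP; split=> l; rewrite /g /= fC => /germC; apply.
have gU x y : g (x `|` y)%O = (g x `|` g y)%classic.
  by rewrite -[(x `|` y)%O]complK complU gC gI !gC setCI !setCK.
have g0 : g \bot%O = set0.
  by rewrite -(meetxC \bot%O) gI gC setICr.
have g1 : g \top%O = setT by rewrite -compl0 gC g0 setC0.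
exists _, (cut_of hC), g; split=> //; split.
- by move=> x _; exact: germ_fu.
- have H x y : g x = g y -> forall z, f x z -> f y z.
    move=> gxy z xz; apply/negPn/negP => yz.
    have [||l] := @germ_nonempty _ _ hC (bsetI (f x) (bsetC (f y))) z.
    + by apply: gen_I => //; exact: gen_C.
    + by rewrite /bsetI /bsetC xz yz.
    + move=> /germI[xl yl]; apply: (germN _ yl).
      by have : g x l by []; rewrite gxy.
  move=> x y _ _ gxy; apply/finj/bsetP => z.
  by apply/idP/idP; apply: H.
- suff ho o p : exists x, g x = half_open o p.
    apply: fu_ind => [|o p A' [x _ <-]]; first by exists \bot%O.
    by have [y <-] := ho o p; exists (y `|` x)%O.
  have lo (u : cut_of hC) : exists x, g x = half_open None (Some u).
    have [[Cu|u0] _] := asboolP _ (valP u).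
      have [x fx] := Cf _ Cu; exists x.
      by apply/seteqP; split=> l; rewrite /g /= fx => /germ_cut.
    exists \bot%O; apply/seteqP; split=> l; rewrite /g /= f0 -u0 => /germ_cut //.
  have hi (u : cut_of hC) : exists x, g x = half_open (Some u) None.
    have [x gx] := lo u; exists (~` x)%O.
    rewrite gC gx; apply/seteqP; split=> l /=; rewrite /half_open /= andbT leNgt.
      by move/negP.
    by move/negP.
  have all : exists x, g x = half_open None None.
    by exists \top%O; rewrite g1; apply/seteqP; split.
  case: o p => [u|] [v|] //.
  have [x gx] := hi u; have [y gy] := lo v; exists (x `&` y)%O.
  rewrite gI gx gy; apply/seteqP; split=> l; rewrite /half_open /= ?andbT.
    by move=> [-> ->].
  by move=> /andP[].
Qed.

(** * Fusion of countably many chains *)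

Section Fusion.
Variable T : Type.
Implicit Types (a b c e s : bset T) (r q : T -> nat) (es : seq (bset T)).

Definition is_field (S : bset T -> Prop) :=
  [/\ S (@bset0 T), forall a, S a -> S (bsetC a) &
      forall a b, S a -> S b -> S (bsetI a b)].

Lemma gen_field S C a : is_field S -> (forall c, C c -> S c) -> gen C a -> S a.
Proof. by move=> [S0 SC SI] CS; elim=> {a}; auto. Qed.

Lemma gen_is_field C : is_field (gen C).
Proof. by split; [exact: gen_0|exact: gen_C|exact: gen_I]. Qed.

Lemma fieldT S : is_field S -> S (@bsetT T).
Proof. by move=> [S0 SC SI]; exact: SC S0. Qed.

Lemma fieldU S a b : is_field S -> S a -> S b -> S (bsetU a b).
Proof.
move=> [S0 SC SI] Sa Sb.
suff -> : bsetU a b = bsetC (bsetI (bsetC a) (bsetC b)) by auto.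
by apply: bsetP => z; rewrite /bsetU /bsetC /bsetI negb_and !negbK.
Qed.

(** A substitute for Boolean terms: a set is put into a field by exhibiting finitely many members on
    which it depends. *)
Lemma field_determined S es (p : bset T) : is_field S ->
  {in es, forall e, S e} ->
  (forall x y, {in es, forall e, e x = e y} -> p x = p y) -> S p.
Proof.
move=> fS; have [S0 SC SI] := fS; elim: es p => [|s es IH] p hes hp.
  have [[z pz]|np] := pselect (exists z, p z).
    suff -> : p = @bsetT T by exact: fieldT.
    by apply: bsetP => w; rewrite (hp w z).
  suff -> : p = @bset0 T by [].
  by apply: bsetP => w; apply/negP => pw; apply: np; exists w.
(* Expansion along s: P v describes p on the points where s has value v, in terms of the remaining
   sets only. *)
pose P v z := `[< exists w, [/\ s w = v, {in es, forall e, e w = e z} & p w] >].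
have SP v : S (P v).
  apply: IH => [e ee|x y xy]; first by apply: hes; rewrite inE ee orbT.
  apply/asboolP/asboolP => -[w [sw ew pw]]; exists w; split=> // e ee.
    by rewrite ew ?xy.
  by rewrite ew ?xy.
suff -> : p = bsetU (bsetI s (P true)) (bsetI (bsetC s) (P false)).
  have Ss : S s by apply: hes; rewrite inE eqxx.
  by apply: fieldU => //; apply: SI => //; exact: SC.
apply: bsetP => z.
have PE : P (s z) z = p z.
  apply/asboolP/idP => [[w [sw ew pw]]|pz]; last by exists z.
  rewrite -(hp w z) // => e; rewrite inE => /orP[/eqP -> //|]; exact: ew.
by rewrite /bsetU /bsetI /bsetC -PE; case: (s z); rewrite /= ?orbF.
Qed.

Definition simple (S0 : bset T -> Prop) (r : T -> nat) :=
  exists es, {in es, forall e, S0 e} /\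
    forall x y, {in es, forall e, e x = e y} -> r x = r y.

Lemma simple_field S0 r (p : pred nat) : is_field S0 -> simple S0 r ->
  S0 (fun z => p (r z)).
Proof.
move=> fS [es [hes hr]]; apply: (field_determined fS hes) => x y xy.
by rewrite (hr x y).
Qed.

Definition const_on c a := forall x y, c x -> c y -> a x = a y.

Lemma count_negP es x y : {in es, forall e, e y -> e x} ->
  (count (fun e => ~~ e x) es <= count (fun e => ~~ e y) es)%N /\
  (count (fun e => ~~ e x) es = count (fun e => ~~ e y) es ->
   {in es, forall e, e x = e y}).
Proof.
elim: es => [|e es IH] h; first by [].
have [|le eq] := IH; first by move=> f fe; apply: h; rewrite inE fe orbT.
have he : (~~ e x <= ~~ e y)%N.
  by have := h e (mem_head _ _); case: (e x) (e y) => [] [] // /(_ isT).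
split=> [|/= E f]; first exact: leq_add.
have E1 : ~~ e x = ~~ e y :> nat.
  by apply/eqP; rewrite eqn_leq he /= -(leq_add2r (count (fun e => ~~ e y) es))
    -E leq_add2l.
rewrite inE => /orP[/eqP ->|]; first by move: E1; case: (e x); case: (e y).
by apply: eq; apply/eqP; rewrite -(eqn_add2l (~~ e x)) E E1.
Qed.

Section FusionLemma.
Variables (S S0 : bset T -> Prop) (G : nat -> bset T -> Prop).
Variable enum0 : nat -> bset T.
Hypotheses (fS : is_field S) (fS0 : is_field S0).
Hypothesis S0S : forall a, S0 a -> S a.
Hypothesis enum0_in : forall n, S0 (enum0 n).
Hypothesis enum0_onto : forall a, S0 a -> exists n, enum0 n = a.
Hypothesis GS : forall k a, G k a -> S a.
Hypothesis G_chain : forall k, is_chain (G k).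
Hypothesis S_gen : forall a, S a -> gen (fun b => S0 b \/ exists k, G k b) a.
(** This lets a partition be refined by s without disturbing the chain G k. *)
Hypothesis G_resolves : forall k s, S0 s -> exists es,
  [/\ {in es, forall e, S0 e},
      {in es, forall e a, G k a -> subb e a \/ subb a e} &
      forall a, G k a -> forall x y, a x -> ~~ a y ->
        {in es, forall e, e x = e y} -> s x = s y].
(** Up to S0, a lives on a core set that the earlier chain does not split, so a piece can be
    reserved for one chain. *)
Hypothesis G_apart : forall j k a, (j < k)%N -> G k a -> exists c,
  [/\ S0 c, S0 (bsetI a (bsetC c)) & forall b, G j b -> const_on c b].

Let level r i : bset T := fun z => r z == i.
Let fresh k c := forall j b, (j < k)%N -> G j b -> const_on c b.

Let good r := simple S0 r /\ exists N, forall z, (r z < N)%N.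

(** In the third clause, only the least chain that splits a piece really constrains how the piece is
    ordered. *)
Let step s r r' := [/\ forall x y, (r x < r y)%N -> (r' x < r' y)%N,
  forall x y, r' x = r' y -> s x = s y &
  forall i k a, fresh k (level r i) -> G k a ->
    forall x y, r x = i -> r y = i -> a x -> ~~ a y -> (r' x <= r' y)%N].

(* Along a chain the number of test sets missed is monotone, and it determines
   which ones are missed. *)
Lemma resolve_chain k s : S0 s -> exists q,
  [/\ good q, forall x y, q x = q y -> s x = s y &
      forall a, G k a -> forall x y, a x -> ~~ a y -> (q x <= q y)%N].
Proof.
move=> Ss; have [es [hes hcmp hsep]] := G_resolves k Ss.
pose n z := count (fun e => ~~ e z) es.
(* The last bit records s. It respects the chain: if a splits a class of points with the same missed
   sets, then s is constant across the split by [hsep]. *)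
exists (fun z => (n z).*2 + ~~ s z); split.
- split.
    exists (s :: es); split=> [e|x y xy].
      by rewrite inE => /orP[/eqP ->|/hes].
    rewrite (xy s) ?mem_head //; congr (_.*2 + _).
    by apply: eq_in_count => e ee; rewrite (xy e) // inE ee orbT.
  exists ((size es).+1.*2) => z; rewrite doubleS -addn2 -addnS.
  rewrite leq_add ?leq_double ?count_size //; by case: (s z).
- move=> x y /(congr1 odd); rewrite !oddD !odd_double.
  by case: (s x); case: (s y).
- move=> a Ga x y ax ay.
  have [|le eq] := @count_negP es x y.
    move=> e ee ey; have [ea|ae] := hcmp e ee a Ga; last exact: ae.
    by move: ay; rewrite ea.
  have [E|lt] := eqVneq (n x) (n y).
    by rewrite E leq_add2l (hsep a Ga x y ax ay (eq E)).
  have {}lt : (n x < n y)%N by rewrite ltn_neqAle lt.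
  apply: leq_trans (leq_addr _ _); apply: leq_trans (_ : (n x).*2.+1 <= _)%N.
    by rewrite -addn1 leq_add2l; case: (s x).
  by rewrite ltn_double.
Qed.

Lemma step_exists s r : S0 s -> good r -> exists2 r', good r' & step s r r'.
Proof.
move=> Ss [[es [hes hr]] [N rN]].
have /choice[q hq] : forall i, exists q, [/\ good q,
    forall x y, q x = q y -> s x = s y &
    forall k a, fresh k (level r i) -> G k a ->
    forall x y, r x = i -> r y = i -> a x -> ~~ a y -> (q x <= q y)%N].
  move=> i.
  (* The least bad index dictates the refinement: smaller chains do not split the piece, and larger
     indices are not fresh on it. *)
  pose bad k := `[< exists a, G k a /\ ~ const_on (level r i) a >].
  have [exk|nk] := pselect (exists k, bad k).
    have [k /asboolP[a0 [Ga0 na0]] mink] := ex_minnP exk.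
    have [q [gq sq aq]] := resolve_chain k Ss; exists q; split=> // j a fj Ga.
    have [jk|kj|jk] := ltngtP j k; last by rewrite jk in Ga => x y _ _; exact: aq.
      move=> x y xi yi ax ay; exfalso; have /asboolPn : ~~ bad j.
        by apply/negP => /mink; rewrite leqNgt jk.
      apply; exists a; split=> // u.
      have xL : level r i x by rewrite /level xi.
      have yL : level r i y by rewrite /level yi.
      by move: ay; rewrite -(u x y) // ax.
    by exfalso; apply: na0; exact: fj Ga0.
  exists (fun z => nat_of_bool (s z)); split.
  - split; last by exists 2 => z; case: (s z).
    exists [:: s]; split=> [e|x y xy]; first by rewrite inE => /eqP ->.
    by rewrite (xy s) ?mem_head.
  - by move=> x y; case: (s x); case: (s y).
  - move=> k a _ Ga x y xi yi ax ay; exfalso; apply: nk; exists k.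
    apply/asboolP; exists a; split=> // u.
    have xL : level r i x by rewrite /level xi.
    have yL : level r i y by rewrite /level yi.
    by move: ay; rewrite -(u x y) // ax.
have /choice[qs hqs] : forall i, exists es, {in es, forall e, S0 e} /\
    forall x y, {in es, forall e, e x = e y} -> q i x = q i y.
  by move=> i; have [[]] := hq i.
have [M hM] : exists M, forall i z, (i < N)%N -> (q i z < M)%N.
  elim: N {rN} => [|N [M hM]]; first by exists 0.
  have [[_ [M' hM']] _ _] := hq N; exists (maxn M M') => i z.
  rewrite ltnS leq_eqVlt leq_max => /orP[/eqP ->|/hM ->//].
  by rewrite hM' orbT.
(* Lexicographic refinement: M bounds the ranks q i, so the old rank dominates. *)
pose r' z := (r z * M + q (r z) z)%N.
have mono x y : (r x < r y)%N -> (r' x < r' y)%N.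
  move=> lt; apply: (@leq_trans ((r x).+1 * M)).
    by rewrite /r' mulSn [(M + _)%N]addnC ltn_add2l hM.
  by apply: leq_trans (leq_addr _ _); rewrite leq_mul2r lt orbT.
have r'r x y : r' x = r' y -> r x = r y.
  move=> E; have [/mono|/mono|//] := ltngtP (r x) (r y); by rewrite E ltnn.
exists r'; first split.
- exists (es ++ flatten [seq qs i | i <- iota 0 N]); split=> [e|x y xy].
    rewrite mem_cat => /orP[/hes //|/flatten_mapP[i _]].
    by have [h _] := hqs i; exact: h.
  have E : r x = r y by apply: hr => e ee; apply: xy; rewrite mem_cat ee.
  rewrite /r' E; congr (_ + _).
  have [_ h] := hqs (r y); apply: h => e ee; apply: xy.
  rewrite mem_cat; apply/orP; right; apply/flatten_mapP; exists (r y) => //.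
  by rewrite mem_iota /= rN.
- exists (N * M)%N => z; apply: (@leq_trans ((r z).+1 * M)).
    by rewrite /r' mulSn [(M + _)%N]addnC ltn_add2l hM.
  by rewrite leq_mul2r rN orbT.
split=> // [x y E|i k a fr Ga x y xi yi ax ay].
  have rE := r'r _ _ E; move: E; rewrite /r' rE => /addnI.
  by have [_ h _] := hq (r y); exact: h.
by rewrite /r' xi yi leq_add2l; have [_ _ h] := hq i; exact: (h k a).
Qed.

(* The sets of C are squeezed between the initial segments of ever finer ranks
   R n. A piece of R n is reserved for the least chain that still splits it:
   within it, all later ranks agree with that chain, so that the sets of that
   chain keep their place. *)
Theorem fusion : exists C : bset T -> Prop,
  [/\ is_chain C, forall c, C c -> S c & forall a, S a -> gen C a].
Proof.
have /choice[F hF] : forall p : nat * (T -> nat), exists r',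
    good p.2 -> good r' /\ step (enum0 p.1) p.2 r'.
  move=> [n r]; have [gr|ng] := pselect (good r); last by exists r.
  by have [r' gr' st] := step_exists (enum0_in n) gr; exists r'.
pose R := fix R n := if n is m.+1 then F (m, R m) else fun _ : T => 0%N.
have gR n : good (R n).
  elim: n => [|n IH]; last by have [] := hF (n, R n) IH.
  by split; [exists [::]|exists 1%N].
have sR n : step (enum0 n) (R n) (R n.+1) by have [] := hF (n, R n) (gR n).
(* A compatible X is an initial segment of pieces plus part of the next one; [promise] says that
   this part is cut out by the chain for which the piece is reserved. *)
pose compat n (X : bset T) := forall x y : T, X x -> ~~ X y -> (R n x <= R n y)%N.
pose promise n (X : bset T) := forall x y : T, X x -> ~~ X y -> R n x = R n y ->
  exists k a, [/\ G k a, fresh k (level (R n) (R n x)) &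
    forall z, R n z = R n x -> X z = a z].
have Rlt m n x y : (m <= n)%N -> (R m x < R m y)%N -> (R n x < R n y)%N.
  move=> /subnK <-; elim: (n - m)%N => // d IH /IH lt.
  by rewrite addSn; have [h _ _] := sR (d + m)%N; exact: h.
have Req m n x y : (m <= n)%N -> R n x = R n y -> R m x = R m y.
  move=> mn E; have [/(Rlt _ _ _ _ mn)|/(Rlt _ _ _ _ mn)|//] := ltngtP (R m x) (R m y);
  by rewrite E ltnn.
have Rle m n x y : (m <= n)%N -> (R n x <= R n y)%N -> (R m x <= R m y)%N.
  by move=> mn; apply: contraTT; rewrite -!ltnNge; exact: Rlt.
have later m n (X : bset T) : (m <= n)%N -> compat m X -> promise m X ->
    compat n X /\ promise n X.
  move=> /subnK <- cX pX; elim: (n - m)%N => [//|d [cd pd]]; rewrite addSn.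
  set l := (d + m)%N in cd pd *; have [st1 _ st3] := sR l; split.
    move=> x y Xx Xy; have := cd x y Xx Xy; rewrite leq_eqVlt => /orP[/eqP E|].
      have [k [a [Ga fr Xa]]] := pd x y Xx Xy E.
      by apply: (st3 _ k a fr Ga); rewrite -?Xa.
    by move/st1/ltnW.
  move=> x y Xx Xy E; have E' := Req l l.+1 x y (leqnSn _) E.
  have [k [a [Ga fr Xa]]] := pd x y Xx Xy E'; exists k, a; split=> //.
    move=> j b jk Gb u v /eqP ul /eqP vl; apply: (fr j b jk Gb u v);
    by apply/eqP; apply: (Req l l.+1).
  by move=> z /(Req l l.+1 _ _ (leqnSn _)); exact: Xa.
pose C (X : bset T) := S X /\ exists n, compat n X /\ promise n X.
have initC n i : C (fun z => (R n z < i)%N).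
  split; first by apply/S0S/(simple_field (fun k => (k < i)%N) fS0); have [] := gR n.
  exists n; split=> x y xi; rewrite -leqNgt => yi.
    exact: ltnW (leq_trans xi yi).
  by move=> E; move: xi; rewrite E ltnNge yi.
have [S_0 SC SI] := fS.
have levelC n i : gen C (level (R n) i).
  suff -> : level (R n) i = bsetI (fun z => (R n z < i.+1)%N)
      (bsetC (fun z => (R n z < i)%N)).
    by apply: gen_I; [|apply: gen_C]; apply: gen_in; exact: initC.
  by apply: bsetP => z; rewrite /bsetI /bsetC ltnS -leqNgt -eqn_leq.
have levels n (X : bset T) : (forall i, gen C (bsetI X (level (R n) i))) ->
    gen C X.
  move=> h; have [_ [N hN]] := gR n.
  suff : gen C (bsetI X (fun z => (R n z < N)%N)).
    by congr (gen C _); apply: bsetP => z; rewrite /bsetI hN andbT.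
  elim: N {hN} => [|N IH].
    suff -> : bsetI X (fun z => (R n z < 0)%N) = @bset0 T by exact: gen_0.
    by apply: bsetP => z; rewrite /bsetI andbF.
  suff -> : bsetI X (fun z => (R n z < N.+1)%N) =
    bsetU (bsetI X (fun z => (R n z < N)%N)) (bsetI X (level (R n) N)).
    exact: gen_U.
  by apply: bsetP => z; rewrite /bsetI /bsetU /level -andb_orr ltnS leq_eqVlt orbC.
have decided s : S0 s -> exists n, forall i, const_on (level (R n) i) s.
  move=> /enum0_onto[n <-]; exists n.+1 => i x y /eqP xi /eqP yi.
  by have [_ h _] := sR n; apply: h; rewrite xi yi.
have genS0 s : S0 s -> gen C s.
  move=> /decided[n hn]; apply: (levels n) => i.
  have [[z /andP[sz zi]]|h] := pselect (exists z, s z && level (R n) i z).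
    suff -> : bsetI s (level (R n) i) = level (R n) i by [].
    apply: bsetP => w; rewrite /bsetI andbC; case wi : (level _ _ w) => //=.
    by rewrite (hn i w z).
  suff -> : bsetI s (level (R n) i) = @bset0 T by exact: gen_0.
  by apply: bsetP => w; apply/negP => hw; apply: h; exists w.
exists C; split; last 1 first.
- move=> a /S_gen; apply: gen_field; first exact: gen_is_field.
  move=> {}a [/genS0 //|[k Ga]].
  have [c [Sc Sac fc]] : exists c, [/\ S0 c, S0 (bsetI a (bsetC c)) & fresh k c].
    suff: forall m, (m <= k)%N -> exists c,
        [/\ S0 c, S0 (bsetI a (bsetC c)) & fresh m c] by move=> /(_ k (leqnn _)).
    elim=> [|m IH] mk.
      exists (@bsetT T); split=> //; first exact: fieldT.
      suff -> : bsetI a (bsetC (@bsetT T)) = @bset0 T by case: fS0.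
      by apply: bsetP => z; rewrite /bsetI andbF.
    have [c [Sc Sac fc]] := IH (ltnW mk).
    have [c' [Sc' Sac' fc']] := G_apart mk Ga.
    have [_ _ SI0] := fS0.
    exists (bsetI c c'); split; first exact: SI0.
      suff -> : bsetI a (bsetC (bsetI c c')) =
        bsetU (bsetI a (bsetC c)) (bsetI a (bsetC c')) by exact: fieldU.
      by apply: bsetP => z; rewrite /bsetI /bsetC /bsetU negb_and andb_orr.
    move=> j b; rewrite ltnS leq_eqVlt => /orP[/eqP ->|jm] Gb x y
      /andP[cx c'x] /andP[cy c'y]; first exact: (fc' b Gb).
    exact: (fc j b jm Gb).
  suff gac : gen C (bsetI a c).
    suff -> : a = bsetU (bsetI a c) (bsetI a (bsetC c)).
      by apply: gen_U => //; exact: genS0.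
    by apply: bsetP => z; rewrite /bsetU /bsetI /bsetC -andb_orr orbN andbT.
  have [n hn] := decided c Sc; apply: (levels n) => i.
  have [[z /andP[cz zi]]|h] := pselect (exists z, c z && level (R n) i z); last first.
    suff -> : bsetI (bsetI a c) (level (R n) i) = @bset0 T by exact: gen_0.
    apply: bsetP => w; apply/negP => /andP[/andP[_ cw] wi]; apply: h.
    by exists w; rewrite cw.
  have lc w : level (R n) i w -> c w by move=> wi; rewrite (hn i w z).
  (* The trace of a on one piece, completed by the earlier pieces so as to be comparable with the
     other sets of C. *)
  pose X := bsetU (fun z => (R n z < i)%N) (bsetI a (level (R n) i)).
  have CX : C X.
    split.
      have [sn _] := gR n; apply: fieldU => //.
        by apply: S0S; exact: (simple_field (fun k => (k < i)%N)).
      apply: SI; first exact: GS Ga.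
      by apply: S0S; exact: (simple_field (fun k => k == i)).
    have XE w : R n w = i -> X w = a w.
      by move=> wi; rewrite /X /bsetU /bsetI /level wi ltnn eqxx andbT.
    have Xle w : X w -> (R n w <= i)%N.
      by move=> /orP[/ltnW //|/andP[_ /eqP ->]].
    have Xge w : ~~ X w -> (i <= R n w)%N.
      by rewrite negb_or -leqNgt => /andP[].
    exists n; split=> x y Xx Xy; first exact: leq_trans (Xle _ Xx) (Xge _ Xy).
    move=> E; have xi : R n x = i.
      by apply/eqP; rewrite eqn_leq Xle // E Xge.
    exists k, a; split=> //; rewrite xi; last exact: XE.
    move=> j b jk Gb u v ul vl; apply: (fc j b jk Gb); exact: lc.
  suff -> : bsetI (bsetI a c) (level (R n) i) = bsetI X (level (R n) i).
    by apply: gen_I => //; exact: gen_in.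
  apply: bsetP => w; rewrite /X /bsetI /bsetU /level.
  have [wi|] := eqVneq (R n w) i; last by rewrite !andbF.
  by rewrite wi ltnn !andbT /= lc ?andbT // /level wi.
- move=> X Y [_ [n [cX pX]]] [_ [n' [cY pY]]].
  apply: contrapT => /not_orP[/not_subb[x Xx Yx] /not_subb[y Yy Xy]].
  have {cX pX} [cX pX] := later n (maxn n n') X (leq_maxl _ _) cX pX.
  have {cY pY} [cY pY] := later n' (maxn n n') Y (leq_maxr _ _) cY pY.
  move: (maxn n n') cX pX cY pY => m cX pX cY pY.
  have E : R m x = R m y by apply/eqP; rewrite eqn_leq cX // cY.
  have [k [a [Ga fa Xa]]] := pX x y Xx Xy E.
  have [k' [a' [Ga' fa' Ya]]] := pY y x Yy Yx (esym E).
  have lx : level (R m) (R m x) x by exact: eqxx.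
  have ly : level (R m) (R m x) y by rewrite /level E.
  have ax : a x by rewrite -Xa.
  have ay : ~~ a y by rewrite -Xa.
  have ay' : a' y by rewrite -Ya.
  have ax' : ~~ a' x by rewrite -Ya.
  (* With different indices, the chain of smaller index would be constant on a piece that one of its
     members splits. *)
  have [kk|kk|kk] := ltngtP k k'.
  + by move: fa'; rewrite -E => /(_ k a kk Ga x y lx ly) ayx; move: ay; rewrite -ayx ax.
  + by have := fa k' a' kk Ga' x y lx ly; rewrite ay' (negbTE ax').
  + rewrite -kk in Ga'; have [h|h] := G_chain Ga Ga'.
      by move: ax'; rewrite h.
    by move: ay; rewrite h.
- by move=> c [].
Qed.

End FusionLemma.
End Fusion.

(** * The lexicographic order on the Cantor space *)

Definition lex := nat -> bool.
HB.instance Definition _ := gen_eqMixin lex.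
HB.instance Definition _ := gen_choiceMixin lex.

Section Lexicographic.
Implicit Types (x y z h : lex) (m n k : nat).

Definition trunc n x : seq bool := mkseq x n.

Lemma truncP n x y :
  trunc n x = trunc n y <-> forall i, (i < n)%N -> x i = y i.
Proof.
split=> [E i lin|H].
  by rewrite -(nth_mkseq false x lin) -/(trunc n x) E nth_mkseq.
by apply/eq_in_map => i; rewrite mem_iota => /H.
Qed.

Lemma trunc_leq m n x y : (m <= n)%N ->
  trunc n x = trunc n y -> trunc m x = trunc m y.
Proof.
by move=> mn /truncP H; apply/truncP => i /leq_trans/(_ mn); exact: H.
Qed.

Lemma take_trunc m n x : (m <= n)%N -> take m (trunc n x) = trunc m x.
Proof. by move=> mn; rewrite /trunc /mkseq -map_take take_iota (minn_idPl mn). Qed.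

Lemma first_difference x y : x != y ->
  exists n, trunc n x = trunc n y /\ x n != y n.
Proof.
move=> xy; have ex : exists n, x n != y n.
  apply/not_existsP => H; case/eqP: xy; apply: funext => n.
  by apply/eqP/negPn/negP; exact: H.
have [n xyn minn] := ex_minnP ex; exists n; split=> //.
apply/truncP => i lin; apply/eqP/negPn/negP => /minn.
by rewrite leqNgt lin.
Qed.

Lemma trunc_sep x y : x != y ->
  exists n, forall m, (n <= m)%N -> trunc m x != trunc m y.
Proof.
move=> /first_difference[n [_ xyn]]; exists n.+1 => m nm; apply/eqP => /truncP E.
by move: xyn; rewrite E ?eqxx.
Qed.

Definition lexlt x y := `[< exists n, [/\ trunc n x = trunc n y, ~~ x n & y n] >].

Fact lexlt_irr : irreflexive lexlt.
Proof. by move=> x; apply/asboolP => -[n [_ /negP]]. Qed.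

Fact lexlt_trans : transitive lexlt.
Proof.
move=> y x z /asboolP[n [xy xn yn]] /asboolP[m [yz ym zm]].
apply/asboolP; exists (minn n m); move/truncP in xy; move/truncP in yz.
split; first apply/truncP => i.
- by rewrite leq_min => /andP[ni mi]; rewrite xy // yz.
- have [nm|mn|E] := ltngtP n m; first by rewrite ?(minn_idPl (ltnW nm)).
    by rewrite xy.
  by [].
- have [nm|mn|E] := ltngtP n m; [by rewrite -yz|by []|by rewrite E].
Qed.

Fact lexlt_total x y : x != y -> lexlt x y || lexlt y x.
Proof.
move=> /first_difference[n [E xyn]]; apply/orP.
case xn : (x n) xyn; case yn : (y n) => // _; [right|left];
  by apply/asboolP; exists n; rewrite ?xn ?yn.
Qed.

HB.instance Definition _ := @Order.LtOrder.Build (Order.Disp tt tt) lex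
  (fun x y => (x == y) || lexlt x y) lexlt
  (fun x y => if lexlt x y then x else y) (fun x y => if lexlt x y then y else x)
  (fun _ _ => erefl) (fun _ _ => erefl) (fun _ _ => erefl)
  lexlt_irr lexlt_trans lexlt_total.

Local Open Scope order_scope.

Lemma lex_ltP x y :
  x < y <-> exists n, [/\ trunc n x = trunc n y, ~~ x n & y n].
Proof. by split=> /asboolP. Qed.

Definition lex_zero : lex := fun=> false.

Lemma lex_zero_le x : lex_zero <= x.
Proof. by rewrite leNgt; apply/negP => /lex_ltP[n []]. Qed.

Lemma trunc_lt n x y x' y' : x < y -> trunc n x != trunc n y ->
  trunc n x' = trunc n x -> trunc n y' = trunc n y -> x' < y'.
Proof.
move=> /lex_ltP[m [/truncP E xm ym]] /eqP nE /truncP Ex /truncP Ey.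
have mn : (m < n)%N.
  rewrite ltnNge; apply/negP => nm; apply: nE; apply/truncP => i lin.
  by apply: E; exact: leq_trans nm.
apply/lex_ltP; exists m; rewrite Ex // Ey //; split=> //.
by apply/truncP => i im; rewrite Ex ?Ey ?E //; exact: ltn_trans mn.
Qed.

Lemma trunc_convex n x y z : x <= y -> y <= z ->
  trunc n x = trunc n z -> trunc n y = trunc n x.
Proof.
move=> xy yz xz; apply/eqP/negPn/negP => yx.
have {}xy : x < y by rewrite lt_neqAle xy andbT; apply: contraNN yx => /eqP ->.
rewrite eq_sym in yx; have := trunc_lt xy yx (esym xz) erefl.
by rewrite ltNge yz.
Qed.

Lemma trunc_lt_near x h : x < h -> exists n, forall m z, (n <= m)%N ->
  trunc m z = trunc m h -> x < z.
Proof.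
move=> xh; have [n hn] := trunc_sep (negbT (lt_eqF xh)).
by exists n => m z nm E; apply: (trunc_lt xh (hn m nm)).
Qed.

Lemma trunc_gt_near x h : h < x -> exists n, forall m z, (n <= m)%N ->
  trunc m z = trunc m h -> z < x.
Proof.
move=> hx; have [n hn] := trunc_sep (negbT (lt_eqF hx)).
by exists n => m z nm E; apply: (trunc_lt hx (hn m nm)).
Qed.

Lemma trunc_sep_seq (X : seq lex) :
  exists n, forall m, (n <= m)%N -> {in X &, injective (trunc m)}.
Proof.
have H x : exists n, forall m y, (n <= m)%N -> y \in X ->
    trunc m x = trunc m y -> x = y.
  elim: X => [|y X [n hn]]; first by exists 0%N.
  have [<-|xy] := eqVneq x y.
    exists n => m z nm; rewrite inE => /orP[/eqP -> //|]; exact: (hn m z nm).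
  have [n' hn'] := trunc_sep xy; exists (maxn n n') => m z.
  rewrite geq_max => /andP[nm n'm]; rewrite inE => /orP[/eqP ->|zX]; last exact: (hn m z nm zX).
  by move=> /eqP; rewrite (negbTE (hn' m n'm)).
have /choice[f hf] := H; exists (\max_(x <- X) f x)%N => m fm x y xX yX.
by apply: hf => //; apply: leq_trans fm; exact: leq_bigmax_seq.
Qed.

End Lexicographic.

(** * Finite symmetric differences of final segments, and their boundaries *)

Section ParitySets.
Local Open Scope order_scope.
Implicit Types (x y z : lex) (F G : seq lex) (a b : bset lex).

(* The symmetric difference of the final segments [y, +oo[, for y in F. *)
Definition par F : bset lex := fun z => odd (count (fun y => y <= z) F).

Lemma par_cat F G z : par (F ++ G) z = par F z (+) par G z.
Proof. by rewrite /par count_cat oddD. Qed.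

Lemma par_cons y F z : par (y :: F) z = (y <= z) (+) par F z.
Proof. by rewrite /par /= oddD oddb. Qed.

Lemma par_perm F G : perm_eq F G -> par F = par G.
Proof. by move=> /permP FG; apply: bsetP => z; rewrite /par FG. Qed.

Lemma parI F G :
  bsetI (par F) (par G) = par [seq Order.max y z | y <- F, z <- G].
Proof.
apply: bsetP => z; rewrite /bsetI; elim: F => [|y F IH] //.
rewrite allpairs_cons par_cat -IH par_cons andb_addl; congr (_ (+) _).
rewrite /par count_map; case yz : (y <= z).
  by congr odd; apply: eq_count => x /=; rewrite ge_max yz.
rewrite [X in _ = odd X](eq_count (a2 := pred0)) ?count_pred0 // => x /=.
by rewrite ge_max yz.
Qed.

Lemma parC F : bsetC (par F) = par (lex_zero :: F).
Proof. by apply: bsetP => z; rewrite par_cons lex_zero_le. Qed.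

Definition reduce F := foldr (fun y G => if y \in G then rem y G else y :: G) [::] F.

Lemma reduce_uniq F : uniq (reduce F).
Proof.
elim: F => //= y F IH; case: ifP => yF; first exact: rem_uniq.
by rewrite /= yF.
Qed.

Lemma mem_reduce F y : (y \in reduce F) = odd (count_mem y F).
Proof.
elim: F => //= x F IH; rewrite oddD -IH oddb.
case: ifP => xF; first rewrite mem_rem_uniq ?reduce_uniq // inE.
  by case: eqVneq => [->|//]; rewrite xF.
by rewrite inE; case: eqVneq => [->|//]; rewrite xF.
Qed.

Lemma par_reduce F : par (reduce F) = par F.
Proof.
apply: bsetP => z; elim: F => //= y F IH; rewrite par_cons -IH.
case: ifP => yF; last by rewrite par_cons.
by rewrite [in RHS](par_perm (perm_to_rem yF)) par_cons addbA addbb.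
Qed.

(** At the least point of F only this point itself is counted, so it would belong to [par F]. *)
Lemma par_eq0 F : uniq F -> par F =1 @bset0 lex -> F = [::].
Proof.
case: F => // x F uF F0; exfalso.
have [m [mF mmin]] : exists m, m \in x :: F /\ {in x :: F, forall y, m <= y}.
  elim: (F) (x) => [|y G IH] z.
    by exists z; split=> [|y]; rewrite inE // => /eqP ->.
  have [m [mG mmin]] := IH y; have [zm|mz] := leP z m.
    exists z; split=> [|t]; rewrite inE ?eqxx // => /orP[/eqP -> //|/mmin].
    exact: le_trans.
  exists m; split=> [|t]; rewrite inE ?mG ?orbT // => /orP[/eqP ->|/mmin //].
  exact: ltW.
have := F0 m; rewrite /par (_ : count _ _ = count_mem m (x :: F)).
  by rewrite count_uniq_mem ?mF.
apply: eq_in_count => y /mmin my; apply/idP/eqP => [ym|-> //].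
by apply/le_anti; rewrite ym my.
Qed.

Definition fin_set a := exists F, a = par F.

(** The representation F is chosen arbitrarily; [mem_bd_par] shows that the resulting points do not
    depend on the choice. *)
Definition bd a : seq lex :=
  if pselect (fin_set a) is left h then reduce (projT1 (cid h)) else [::].

Lemma bd_uniq a : uniq (bd a).
Proof. by rewrite /bd; case: pselect => // h; exact: reduce_uniq. Qed.

Lemma par_bd a : fin_set a -> par (bd a) = a.
Proof.
by rewrite /bd; case: pselect => // h _; rewrite par_reduce; case: cid.
Qed.

Lemma mem_bd_par F y : (y \in bd (par F)) = odd (count_mem y F).
Proof.
have : reduce (bd (par F) ++ F) = [::].
  apply: par_eq0 (reduce_uniq _) _ => z; rewrite par_reduce par_cat par_bd ?addbb //.
  by exists F.
move=> E; have := mem_reduce (bd (par F) ++ F) y.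
rewrite E in_nil count_cat oddD count_uniq_mem ?bd_uniq // oddb => /esym/negbT.
by rewrite -negb_eqb negbK => /eqP.
Qed.

Lemma bd_sub a (P : lex -> Prop) F : a = par F -> {in F, forall y, P y} ->
  {in bd a, forall y, P y}.
Proof.
move=> -> FP y; rewrite mem_bd_par => h; apply: FP.
by rewrite -has_pred1 has_count; case: count h.
Qed.

Lemma bd_xor a b y : fin_set a -> fin_set b ->
  (y \in bd (fun z => a z (+) b z)) = (y \in bd a) (+) (y \in bd b).
Proof.
move=> [F ->] [G ->]; rewrite (_ : (fun _ => _) = par (F ++ G)).
  by rewrite !mem_bd_par count_cat oddD.
by apply: bsetP => z; rewrite par_cat.
Qed.

Lemma bdC a y : fin_set a -> y != lex_zero -> (y \in bd (bsetC a)) = (y \in bd a).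
Proof.
move=> [F ->] y0; rewrite parC !mem_bd_par /= eq_sym (negbTE y0).
by rewrite add0n.
Qed.

(** Two final segments meet in the one with the larger endpoint. As y is not in bd b, it arises only
    from pairs (y, g) with g below y, and b y is the parity of the number of such g. *)
Lemma bdI a b y : fin_set a -> fin_set b -> y \notin bd b ->
  (y \in bd (bsetI a b)) = (y \in bd a) && b y.
Proof.
move=> [F ->] fb yG; rewrite -(par_bd fb); set G := bd b in yG *.
rewrite parI !mem_bd_par /par -oddM; congr odd; set c := count _ G.
elim: F => [|f F IH] //; rewrite allpairs_cons count_cat IH /= mulnDl.
congr (_ + _)%N; rewrite count_map; have [->|fy] := eqVneq f y.
  rewrite mul1n; apply: eq_in_count => g gG /=.
  by apply/eqP/idP => [<-|/max_idPl //]; rewrite le_max lexx orbT.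
rewrite mul0n (eq_in_count (a2 := pred0)) ?count_pred0 // => g gG /=.
apply/negP; case: leP => _ /eqP E; first by rewrite -E gG in yG.
by rewrite E eqxx in fy.
Qed.

Lemma fin_setI a b : fin_set a -> fin_set b -> fin_set (bsetI a b).
Proof. by move=> [F ->] [G ->]; rewrite parI; eexists. Qed.

Lemma bdC_sub a y : fin_set a -> y \in bd (bsetC a) -> y = lex_zero \/ y \in bd a.
Proof.
by move=> fa; have [->|y0] := eqVneq y lex_zero; [left|rewrite bdC //; right].
Qed.

Lemma bdI_sub a b y : fin_set a -> fin_set b -> y \in bd (bsetI a b) ->
  y \in bd a \/ y \in bd b.
Proof.
move=> fa fb; have [yb|yb] := boolP (y \in bd b); first by right.
by rewrite bdI // => /andP[]; left.
Qed.

End ParitySets.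

(** * Subalgebras of B(L) *)

Section Cells.
Local Open Scope order_scope.
Implicit Types (x y : seq bool -> lex) (p q w h : lex) (K : seq lex)
  (T : seq (seq bool)) (u v : seq bool).

Lemma le_cells d p p' w w' : trunc d p = trunc d p' -> trunc d w = trunc d w' ->
  trunc d p != trunc d w -> (p <= w) = (p' <= w').
Proof.
move=> E E' pw; have [lt|lt|E''] := ltgtP p w; last by rewrite E'' eqxx in pw.
  by apply/esym/ltW/(trunc_lt lt pw).
rewrite eq_sym in pw; apply/esym/negbTE; rewrite -ltNge.
exact: (trunc_lt lt pw).
Qed.

Definition cells d T y := {in T, forall u, trunc d (y u) = u}.

Definition par_cells K T y := par (K ++ map y T).

Definition separated d K T := uniq T /\ {in K, forall k, trunc d k \notin T}.

Lemma par_cellsE K T y w : par_cells K T y w = par K w (+) par (map y T) w.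
Proof. exact: par_cat. Qed.

Lemma par_map_eq d T x y w w' : cells d T x -> cells d T y ->
  trunc d w = trunc d w' -> trunc d w \notin T ->
  par (map x T) w = par (map y T) w'.
Proof.
move=> cx cy E wT; rewrite /par !count_map; congr odd.
apply: eq_in_count => v vT /=; apply: (@le_cells d) => //.
  by rewrite cx // cy.
by rewrite cx //; apply: contraNneq wT => <-.
Qed.

Lemma par_far d K w w' T : {in K, forall k, trunc d k \notin T} ->
  trunc d w \in T -> trunc d w = trunc d w' -> par K w = par K w'.
Proof.
move=> KT wT E; rewrite /par; congr odd; apply: eq_in_count => k kK.
by apply: (@le_cells d) => //; apply: contraNneq (KT k kK) => ->.
Qed.

(* Inside one cell, a set of a given type is a half-line up to a constant
   depending only on the type. *)
Lemma par_cells_in d K T x y u w w' : separated d K T ->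
  cells d T x -> cells d T y -> u \in T -> trunc d w = u -> trunc d w' = u ->
  par_cells K T x w (+) (x u <= w) = par_cells K T y w' (+) (y u <= w').
Proof.
move=> [uT KT] cx cy uin wu wu'; rewrite !par_cellsE.
have E : trunc d w = trunc d w' by rewrite wu.
rewrite (par_far KT _ E) ?wu // -!addbA; congr (_ (+) _).
have H z t : par (map z T) t (+) (z u <= t) = par (map z (rem u T)) t.
  rewrite (par_perm (perm_map z (perm_to_rem uin))) /= par_cons.
  by rewrite addbC addbA addbb.
have sub z : cells d T z -> cells d (rem u T) z by move=> cz v /mem_rem; exact: cz.
rewrite !H; apply: (par_map_eq (sub _ cx) (sub _ cy) E).
by rewrite wu mem_rem_uniq // inE eqxx.
Qed.

Lemma par_cells_out d K T x y w : cells d T x -> cells d T y ->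
  trunc d w \notin T -> par_cells K T x w = par_cells K T y w.
Proof.
by move=> cx cy wT; rewrite !par_cellsE; congr (_ (+) _); exact: (par_map_eq cx cy).
Qed.

Lemma par_cells_xor d K T x y w : separated d K T -> cells d T x -> cells d T y ->
  par_cells K T x w (+) par_cells K T y w =
  (trunc d w \in T) && ((x (trunc d w) <= w) (+) (y (trunc d w) <= w)).
Proof.
move=> sT cx cy; have [wT|wT] := boolP (trunc d w \in T); last first.
  by rewrite (par_cells_out K cx cy wT) addbb.
have := par_cells_in sT cx cy wT erefl erefl.
by case: (par_cells K T x w); case: (par_cells K T y w); case: (_ <= _);
  case: (_ <= _).
Qed.

(** In each cell the two sets differ exactly between their boundary points, and the value of the
    second set at x u tells which one is larger there. *)
Lemma par_cells_cmp d K T x y b : separated d K T -> cells d T x -> cells d T y ->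
  {in T, forall u, par_cells K T y (x u) = b} ->
  if b then subb (par_cells K T x) (par_cells K T y)
  else subb (par_cells K T y) (par_cells K T x).
Proof.
move=> sT cx cy yx.
suff H w : if b then par_cells K T x w -> par_cells K T y w
    else par_cells K T y w -> par_cells K T x w by case: b H {yx}.
have [wT|wT] := boolP (trunc d w \in T); last first.
  by rewrite (par_cells_out K cx cy wT); case: b {yx}.
set u := trunc d w in wT.
have := par_cells_in sT cx cy wT erefl (erefl : trunc d w = u).
have := par_cells_in sT cy cy wT (cx u wT) (erefl : trunc d w = u).
rewrite (yx u wT); have [yxu|xyu] := leP (y u) (x u).
  have := @le_trans _ _ (x u) (y u) w yxu.
  by case: b {yx}; case: (par_cells K T x w); case: (par_cells K T y w);
    case: (x u <= w); case: (y u <= w) => // /(_ isT).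
have := @le_trans _ _ (y u) (x u) w (ltW xyu).
by case: b {yx}; case: (par_cells K T x w); case: (par_cells K T y w);
    case: (x u <= w); case: (y u <= w) => // /(_ isT).
Qed.

End Cells.

(** * The countable hull of boundary points *)

Section Closure.
Local Open Scope order_scope.
Variable S : bset lex -> Prop.
Implicit Types (x y : seq bool -> lex) (p q w h : lex) (K : seq lex)
  (T : seq (seq bool)) (u v : seq bool).

(* A type is a triple (d, K, T): a set has this type when its boundary consists
   of the points K and of one point y u in each cell u of T, where a cell is
   the set of points with a given truncation to d bits. *)
Definition admissible d K T y := cells d T y /\ S (par_cells K T y).

(** A witness with the coordinate u in a prescribed basic open set, or least, or greatest: these
    requests suffice for approximation from both sides. *)
Definition skolem_spec d K T u (m : seq bool + bool) y :=
  admissible d K T y /\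
  match m with
  | inl w => trunc (size w) (y u) = w
  | inr true => forall y', admissible d K T y' -> y u <= y' u
  | inr false => forall y', admissible d K T y' -> y' u <= y u
  end.

Definition skolem (Q : (seq bool -> lex) -> Prop) : seq bool -> lex :=
  if pselect (exists y, Q y) is left h then projT1 (cid h) else fun=> lex_zero.

Lemma skolemP Q y : Q y -> Q (skolem Q).
Proof.
move=> Qy; rewrite /skolem; case: pselect => [h|nh]; first by case: cid.
by exfalso; apply: nh; exists y.
Qed.

Definition skolem_code : countType :=
  (nat * seq (seq bool) * seq bool * (seq bool + bool) * seq bool)%type.

(** A node label codes a Skolem function, and the children are terms for its parameters K;
    countability of the hull is that of the trees. *)
Fixpoint hull (t : GenTree.tree bool) : lex :=
  if t is GenTree.Node n ts then
    if (unpickle n : option skolem_code) is Some (d, T, u, m, v) then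
      skolem (skolem_spec d (map hull ts) T u m) v
    else lex_zero
  else lex_zero.

(* The boundary points in a countable elementary hull, given by all terms
   over the Skolem functions. *)
Definition old p := exists t, hull t = p.

Lemma old0 : old lex_zero.
Proof. by exists (GenTree.Leaf true). Qed.

Lemma old_seq K : {in K, forall k, old k} -> exists ts, K = map hull ts.
Proof.
elim: K => [|k K IH] oK; first by exists [::].
have [t <-] := oK k (mem_head _ _); have [|ts ->] := IH.
  by move=> k' kK; apply: oK; rewrite inE kK orbT.
by exists (t :: ts).
Qed.

Lemma old_skolem K d T u m v : {in K, forall k, old k} ->
  old (skolem (skolem_spec d K T u m) v).
Proof.
move=> /old_seq[ts ->].
exists (GenTree.Node (pickle ((d, T, u, m, v) : skolem_code)) ts).
by rewrite /= pickleK.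
Qed.

(** Either some admissible z has a smaller coordinate u, and the hull has a witness so close to z
    that it stays below y u; or y u is least, and the hull attains it. *)
Lemma old_le d K T y u : {in K, forall k, old k} -> admissible d K T y ->
  exists y', [/\ admissible d K T y', forall v, old (y' v) & y' u <= y u].
Proof.
move=> oK ay; have [[z [az zy]]|H] :=
  pselect (exists z, admissible d K T z /\ z u < y u).
  have [n hn] := trunc_sep (negbT (lt_eqF zy)).
  set Q := skolem_spec d K T u (inl (trunc n (z u))).
  have [ak] : Q (skolem Q) by apply: (@skolemP _ z); split; rewrite ?size_mkseq.
  rewrite size_mkseq => tk; exists (skolem Q); split=> // [v|]; first exact: old_skolem.
  exact/ltW/(trunc_lt zy (hn n (leqnn n))).
set Q := skolem_spec d K T u (inr true).
have [ak mk] : Q (skolem Q).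
  apply: (@skolemP _ y); split=> // z az; rewrite leNgt; apply/negP => lt.
  by apply: H; exists z.
by exists (skolem Q); split=> // [v|]; [exact: old_skolem|exact: mk].
Qed.

Lemma old_ge d K T y u : {in K, forall k, old k} -> admissible d K T y ->
  exists y', [/\ admissible d K T y', forall v, old (y' v) & y u <= y' u].
Proof.
move=> oK ay; have [[z [az yz]]|H] :=
  pselect (exists z, admissible d K T z /\ y u < z u).
  have [n hn] := trunc_sep (negbT (lt_eqF yz)).
  set Q := skolem_spec d K T u (inl (trunc n (z u))).
  have [ak] : Q (skolem Q) by apply: (@skolemP _ z); split; rewrite ?size_mkseq.
  rewrite size_mkseq => tk; exists (skolem Q); split=> // [v|]; first exact: old_skolem.
  exact/ltW/(trunc_lt yz (hn n (leqnn n))).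
set Q := skolem_spec d K T u (inr false).
have [ak mk] : Q (skolem Q).
  apply: (@skolemP _ y); split=> // z az; rewrite leNgt; apply/negP => lt.
  by apply: H; exists z.
by exists (skolem Q); split=> // [v|]; [exact: old_skolem|exact: mk].
Qed.

End Closure.

Lemma fieldX T (S : bset T -> Prop) a b : is_field S -> S a -> S b ->
  S (fun z => a z (+) b z).
Proof.
move=> fS Sa Sb; have [_ SC SI] := fS.
suff -> : (fun z => a z (+) b z) = bsetU (bsetI a (bsetC b)) (bsetI (bsetC a) b).
  by apply: fieldU => //; apply: SI => //; exact: SC.
by apply: bsetP => z; rewrite /bsetU /bsetI /bsetC; case: (a z); case: (b z).
Qed.

(** * Irreducible sets over the core *)

Section Irreducible.
Local Open Scope order_scope.
Variable S : bset lex -> Prop.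
Hypotheses (fS : is_field S) (Sfin : forall a, S a -> fin_set a).
Implicit Types (a b c s : bset lex) (y : seq bool -> lex) (p q w h : lex)
  (K : seq lex) (T : seq (seq bool)) (u v : seq bool).

Local Notation old := (old S).

(* The countable subalgebra over which S is analysed. *)
Definition core a := S a /\ {in bd a, forall p, old p}.

(* New boundary points. *)
Definition nb a := [seq p <- bd a | `[< ~ old p >]].

Lemma mem_nb a p : p \in nb a <-> p \in bd a /\ ~ old p.
Proof.
by rewrite mem_filter; split=> [/andP[/asboolP]|[? ?]] //; apply/andP; split=> //;
  apply/asboolP.
Qed.

Lemma nb_uniq a : uniq (nb a). Proof. exact/filter_uniq/bd_uniq. Qed.

Lemma core_field : is_field core.
Proof.
have [S0 SC SI] := fS; split.
- by split=> // p; rewrite (_ : @bset0 lex = par [::]) // mem_bd_par.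
- move=> a [Sa oa]; split=> [|y]; first exact: SC.
  by move=> /(bdC_sub (Sfin Sa))[->|/oa //]; exact: old0.
- move=> a b [Sa oa] [Sb ob]; split=> [|y]; first exact: SI.
  by move=> /(bdI_sub (Sfin Sa) (Sfin Sb))[/oa|/ob].
Qed.

Lemma core_old s p : core s -> ~ old p -> p \notin bd s.
Proof. by move=> [_ os] np; apply/negP => /os. Qed.

Lemma core_nb a : S a -> (forall p, p \notin nb a) -> core a.
Proof.
move=> Sa na; split=> // p pa; apply: contrapT => op.
by have /negP := na p; apply; apply/mem_nb.
Qed.

Lemma nbC a p : S a -> (p \in nb (bsetC a)) = (p \in nb a).
Proof.
move=> Sa; have [op|op] := pselect (old p).
  by apply/idP/idP => /mem_nb[].
have p0 : p != lex_zero by apply/eqP => p0; apply: op; rewrite p0; exact: old0.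
by rewrite !mem_filter bdC //; exact: Sfin.
Qed.

Lemma nbI a s p : S a -> core s -> (p \in nb (bsetI a s)) = (p \in nb a) && s p.
Proof.
move=> Sa Cs; have [op|op] := pselect (old p).
  by apply/idP/idP => [/mem_nb[]//|/andP[/mem_nb[]]].
rewrite !mem_filter bdI ?andbA //; [exact: Sfin|by apply: Sfin; case: Cs|].
exact: core_old.
Qed.

Lemma nbX a b p : S a -> S b ->
  (p \in nb (fun z => a z (+) b z)) = (p \in nb a) (+) (p \in nb b).
Proof.
move=> Sa Sb; rewrite !mem_filter bd_xor; [|exact: Sfin|exact: Sfin].
by case: `[< _ >].
Qed.

Lemma core_xor a b : S a -> S b -> nb a =i nb b -> core (fun z => a z (+) b z).
Proof.
move=> Sa Sb ab; apply: core_nb => [|p]; first exact: fieldX.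
by rewrite nbX // ab addbb.
Qed.

Lemma core_enum : exists e : nat -> bset lex, (forall n, core (e n)) /\
  forall a, core a -> exists n, e n = a.
Proof.
pose e n := if unpickle n is Some ts
  then let a := par (map (hull S) ts) in if `[< core a >] then a else @bset0 lex
  else @bset0 lex.
exists e; split=> [n|a Ca].
  have [C0 _ _] := core_field.
  by rewrite /e; case: unpickle => // ts /=; case: asboolP.
have [ts E] : exists ts, bd a = map (hull S) ts by apply: old_seq; case: Ca.
exists (pickle ts); rewrite /e pickleK /= -E par_bd; last by apply: Sfin; case: Ca.
by case: asboolP.
Qed.

Definition rep d K T y a := [/\ separated d K T, {in K, forall k, old k},
  a = par_cells K T y, cells d T y & map y T = nb a].

Lemma rep_exists d a : S a -> {in bd a &, injective (trunc d)} ->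
  exists K T y, rep d K T y a.
Proof.
move=> Sa inj; exists [seq p <- bd a | `[< old p >]], (map (trunc d) (nb a)).
have inb q : q \in nb a -> q \in bd a by move=> /mem_nb[].
pose y u := nth lex_zero (nb a) (index u (map (trunc d) (nb a))); exists y.
have yE q : q \in nb a -> y (trunc d q) = q.
  move=> qa; rewrite /y -[RHS](nth_index lex_zero qa); congr nth.
  have : {in nb a, forall q', trunc d q' = trunc d q -> q' = q}.
    by move=> q' q'a; apply: inj; exact: inb.
  elim: (nb a) => //= q' X IH inj'; have [->|q'q] := eqVneq q' q; first by rewrite eqxx.
  have [/inj'|_] := eqVneq (trunc d q') (trunc d q).
    by rewrite mem_head => /(_ isT) E; rewrite E eqxx in q'q.
  by rewrite IH // => x xX; apply: inj'; rewrite inE xX orbT.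
have mapy : map y (map (trunc d) (nb a)) = nb a.
  by rewrite -map_comp -[RHS]map_id; apply/eq_in_map => q /yE.
split=> //.
- split.
    by rewrite map_inj_in_uniq ?nb_uniq // => q q' /inb qa /inb q'a; exact: inj.
  move=> k; rewrite mem_filter => /andP[/asboolP ok ka]; apply/negP => /mapP[q qa E].
  by move: (qa) => /mem_nb[qb nq]; apply: nq; rewrite -(inj _ _ ka qb E).
- by move=> k; rewrite mem_filter => /andP[/asboolP].
- rewrite /par_cells mapy -[LHS](par_bd (Sfin Sa)); apply: par_perm.
  have -> : nb a = filter (predC (fun p => `[< old p >])) (bd a).
    by apply: eq_filter => x; exact: asbool_neg.
  rewrite perm_sym; exact: (permEl (perm_filterC (fun p => `[< old p >]) (bd a))).
- by move=> u /mapP[q qa ->]; rewrite yE.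
Qed.

(** At this depth, a point of X in the cell of a boundary point of a is equal to it. *)
Lemma rep_deep a (X : seq lex) : S a -> exists d K T y,
  rep d K T y a /\ {in X ++ bd a &, injective (trunc d)}.
Proof.
move=> Sa; have [d hd] := trunc_sep_seq (X ++ bd a).
have inj := hd d (leqnn d); have [|K [T [y r]]] := @rep_exists d a Sa.
  by move=> p q pa qa; apply: inj; rewrite mem_cat ?pa ?qa orbT.
by exists d, K, T, y.
Qed.

Lemma rep_mem d K T y a q : rep d K T y a -> q \in nb a ->
  trunc d q \in T /\ y (trunc d q) = q.
Proof. by move=> [_ _ _ cy <-] /mapP[u uT ->]; rewrite cy. Qed.

Lemma core_cells K T y d : {in K, forall k, old k} -> (forall v, old (y v)) ->
  admissible S d K T y -> core (par_cells K T y).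
Proof.
move=> oK oy [_ Sy]; split=> //; apply: (@bd_sub _ old (K ++ map y T)) => // z.
by rewrite mem_cat => /orP[/oK //|/mapP[u _ ->]].
Qed.

(** The inequalities are strict because y u is new while y1 u and y2 u are old. *)
Lemma rep_approx d K T y a u : S a -> rep d K T y a -> u \in T ->
  exists y1 y2, [/\ cells d T y1, cells d T y2, core (par_cells K T y1),
    core (par_cells K T y2) & y1 u < y u /\ y u < y2 u].
Proof.
move=> Sa [sT oK E cy nE] uT; have ay : admissible S d K T y by split; rewrite -?E.
have [_ nu] : y u \in bd a /\ ~ old (y u) by apply/mem_nb; rewrite -nE map_f.
have [y1 [ay1 oy1 le1]] := old_le u oK ay.
have [y2 [ay2 oy2 le2]] := old_ge u oK ay.
exists y1, y2; split; [by case: ay1|by case: ay2|exact: (core_cells oK oy1 ay1)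
  |exact: (core_cells oK oy2 ay2)|split; rewrite lt_neqAle ?le1 ?le2 andbT].
  by apply/eqP => E1; apply: nu; rewrite -E1.
by apply/eqP => E1; apply: nu; rewrite E1.
Qed.

(* The new boundary points lie over a single point of the Stone space of the
   core; up to a core set, a is then determined by them (core_xor). *)
Definition irr a := [/\ S a, exists p, p \in nb a &
  forall s, core s -> {in nb a &, forall p q, s p = s q}].

(** Induction on the number of new boundary points: a core set that separates two of them splits a
    into two sets with fewer. *)
Lemma irr_gen a : S a -> gen (fun b => core b \/ irr b) a.
Proof.
have [n] := ubnP (size (nb a)); elim: n a => // n IH a; rewrite ltnS => an Sa.
have [ia|nia] := pselect (irr a); first by apply: gen_in; right.
have [/hasP[p pa _]|nbn] := boolP (has predT (nb a)); last first.
  apply: gen_in; left; apply: core_nb => // p; apply/negP => pa.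
  by case/hasP: nbn; exists p.
have [s [Cs [q [q' [qa q'a sq]]]]] : exists s, core s /\ exists q q',
    [/\ q \in nb a, q' \in nb a & s q != s q'].
  apply: contrapT => H; apply: nia; split=> //; first by exists p.
  move=> s Cs q q' qa q'a; apply/eqP/negPn/negP => sq.
  by apply: H; exists s; split=> //; exists q, q'.
have [_ SC SI] := fS.
have part t : core t -> (exists2 r, r \in nb a & ~~ t r) ->
    gen (fun b => core b \/ irr b) (bsetI a t).
  move=> Ct [r ra tr]; apply: IH; last by apply: SI => //; case: Ct.
  apply: leq_trans an.
  have sub : {subset r :: nb (bsetI a t) <= nb a}.
    by move=> x; rewrite inE nbI // => /orP[/eqP ->|/andP[]].
  apply: (uniq_leq_size _ sub); rewrite /= nb_uniq andbT nbI //.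
  by rewrite (negbTE tr) andbF.
suff -> : a = bsetU (bsetI a s) (bsetI a (bsetC s)).
  have [_ CC _] := core_field; apply: gen_U; [apply: part => //|apply: part; first exact: CC].
    by case sq' : (s q) sq; [exists q'|exists q] => //; rewrite ?sq' //; case: (s q') sq.
  by case sq' : (s q) sq; [exists q|exists q'] => //;
    rewrite /bsetC ?sq' ?negbK //; case: (s q') sq.
by apply: bsetP => z; rewrite /bsetU /bsetI /bsetC -andb_orr orbN andbT.
Qed.

(** At a depth that separates nb a from bd b, the set b agrees with a core set outside the cells of
    its own new boundary points, hence on nb a. *)
Lemma irr_const a b : irr a -> S b -> (forall q, q \in nb a -> q \notin nb b) ->
  {in nb a &, forall p q, b p = b q}.
Proof.
move=> [Sa _ ia] Sb ab; have [d [K [T [y [r inj]]]]] := rep_deep (nb a) Sb.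
have [/hasP[u uT _]|nT] := boolP (has predT T); last first.
  apply: ia; apply: core_nb => // p; apply/negP => /(rep_mem r)[pT _].
  by case/hasP: nT; exists (trunc d p).
have [y1 [_ [cy1 _ Cy1 _ _]]] := rep_approx Sb r uT.
have [sT _ bE cy nE] := r.
have agr q : q \in nb a -> b q = par_cells K T y1 q.
  move=> qa; rewrite bE; apply: (par_cells_out _ cy cy1); apply/negP => qT.
  have yb : y (trunc d q) \in nb b by rewrite -nE map_f.
  have /negP := ab q qa; apply; suff -> : q = y (trunc d q) by [].
  apply: inj; rewrite ?mem_cat ?qa ?cy //.
  by move: yb => /mem_nb[-> _]; rewrite orbT.
by move=> p q pa qa; rewrite !agr //; exact: ia.
Qed.

(** The symmetric difference of two core sets that bracket b at p lives in the cells of nb b; if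
    these are small enough, they contain no other point of X. *)
Lemma nb_neighbourhood b (X : seq lex) p : S b -> p \in nb b -> exists c,
  [/\ core c, c p & forall w, w \in X -> c w -> w \in nb b].
Proof.
move=> Sb pb; have [d [K [T [y [r inj]]]]] := rep_deep X Sb.
have [pT yp] := rep_mem r pb.
have [y1 [y2 [cy1 cy2 Cy1 Cy2 []]]] := rep_approx Sb r pT.
rewrite yp => lt1 lt2; have [sT _ bE cy nE] := r.
exists (fun z => par_cells K T y1 z (+) par_cells K T y2 z); split.
- by apply: fieldX => //; exact: core_field.
- by rewrite (par_cells_xor _ sT cy1 cy2) pT (ltW lt1) leNgt lt2.
- move=> w wX; rewrite (par_cells_xor _ sT cy1 cy2) => /andP[wT _].
  have yb : y (trunc d w) \in nb b by rewrite -nE map_f.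
  suff -> : w = y (trunc d w) by [].
  apply: inj; rewrite ?mem_cat ?wX ?cy //.
  by move: yb => /mem_nb[-> _]; rewrite orbT.
Qed.

Lemma irr_sub a b p : irr a -> S b -> p \in nb a -> p \in nb b ->
  {subset nb a <= nb b}.
Proof.
move=> [Sa _ ia] Sb pa pb q qa.
have [c [Cc cp cw]] := nb_neighbourhood [:: q] Sb pb.
by apply: cw; rewrite ?mem_head // (ia c Cc q p).
Qed.

Lemma irr_eq a b p : irr a -> irr b -> p \in nb a -> p \in nb b -> nb a =i nb b.
Proof.
move=> ia ib pa pb q; have [Sa _ _] := ia; have [Sb _ _] := ib.
by apply/idP/idP; [exact: (irr_sub ia Sb pa pb)|exact: (irr_sub ib Sa pb pa)].
Qed.

Lemma irrC a : irr a -> irr (bsetC a).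
Proof.
move=> [Sa [p pa] ia]; have [_ SC _] := fS; split; first exact: SC.
  by exists p; rewrite nbC.
by move=> s Cs q q'; rewrite !nbC //; exact: ia.
Qed.

End Irreducible.

Lemma countable_subsingletons (I : countType) U (A : set U) (B : I -> set U) :
  (forall x, A x -> exists i, B i x) ->
  (forall i x y, B i x -> B i y -> x = y) -> countable A.
Proof.
move=> AB Bs; apply: (@sub_countable _ _ _ (\bigcup_(i in [set: I]) B i)%classic).
  by apply: subset_card_le => x /AB[i]; exists i.
apply: bigcup_countable => // i _; apply/countable_injP; exists (fun=> 0%N).
by move=> x y /set_mem Bx /set_mem By _; exact: Bs Bx By.
Qed.

(** * Irreducible sets of one type, ordered by position *)

Section TypedFamily.
Local Open Scope order_scope.
Variable S : bset lex -> Prop.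
Hypotheses (fS : is_field S) (Sfin : forall a, S a -> fin_set a).
Variables (d : nat) (K : seq lex) (T : seq (seq bool)).
Implicit Types (a b c s : bset lex) (e x y z : seq bool -> lex)
  (p q w l h : lex) (u v : seq bool) (k : nat).

Local Notation old := (old S).
Local Notation val := (par_cells K T).
Local Notation nb := (nb S).
Local Notation core := (core S).
Local Notation irr := (irr S).

Definition pos y : lex := y (head [::] T).

(* The normalisation val y (pos y) = false makes inclusion of members agree with
   the order of their positions. *)
Definition new_member y := [/\ separated d K T, {in K, forall p, old p},
  cells d T y, {in T, forall u, ~ old (y u)} &
  irr (val y) /\ val y (pos y) = false].

Definition core_member y :=
  [/\ cells d T y, core (val y) & {in T, forall u, old (y u)}].

Lemma nb_par_cells y : separated d K T -> {in K, forall p, old p} ->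
  cells d T y -> {in T, forall u, ~ old (y u)} -> nb (val y) =i map y T.
Proof.
move=> [uT _] oK cy ny p; have uy : uniq (map y T).
  by rewrite map_inj_in_uniq // => u v uT' vT E; rewrite -(cy u) // E cy.
have mapn : p \in map y T -> ~ old p by move=> /mapP[u uT' ->]; exact: ny.
have [op|np] := pselect (old p).
  by apply/idP/idP => [/mem_nb[]//|/mapn].
have -> : (p \in nb (val y)) = (p \in bd (val y)).
  by apply/idP/idP => [/mem_nb[]//|pb]; apply/mem_nb.
rewrite mem_bd_par count_cat (count_memPn _) ?count_uniq_mem ?oddb //.
by apply/negP => /oK.
Qed.

Lemma new_nb y : new_member y -> nb (val y) =i map y T.
Proof. by move=> [sT oK cy ny _]; exact: nb_par_cells. Qed.

Lemma new_head y : new_member y -> head [::] T \in T.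
Proof.
move=> gy; have [_ _ _ _ [[_ [p pv] _] _]] := gy.
by move: pv; rewrite new_nb //; case: (T) => //= u U _; exact: mem_head.
Qed.

Lemma new_pos y : new_member y -> pos y \in nb (val y).
Proof. by move=> gy; rewrite (new_nb gy); apply: map_f; exact: new_head gy. Qed.

Lemma pos_cell y z : new_member y -> cells d T z -> trunc d (pos z) = head [::] T.
Proof. by move=> gy cz; rewrite cz // (new_head gy). Qed.

Lemma val_pos x z w : new_member x -> cells d T z -> trunc d w = head [::] T ->
  val z w = (w < pos z).
Proof.
move=> gx cz wh; have hT := new_head gx; have [sT _ cx _ [_ x0]] := gx.
have := par_cells_in sT cz cx hT wh (cx _ hT).
rewrite -/(pos x) x0 lexx ltNge -/(pos z).
by case: (val z w); case: (_ <= _).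
Qed.

Lemma new_cell_mem y p : new_member y -> p \in nb (val y) ->
  trunc d p \in T /\ y (trunc d p) = p.
Proof.
move=> gy; rewrite new_nb // => /mapP[u uT ->].
by have [_ _ cy _ _] := gy; rewrite cy.
Qed.

Lemma new_meet x y p : new_member x -> new_member y -> p \in nb (val x) ->
  p \in nb (val y) -> val x = val y.
Proof.
move=> gx gy px py; have [_ _ cx _ [ix _]] := gx; have [_ _ cy _ [iy _]] := gy.
have E := irr_eq fS Sfin ix iy px py; rewrite /par_cells; congr (par (_ ++ _)).
apply/eq_in_map => u uT.
have [_] : trunc d (x u) \in T /\ y (trunc d (x u)) = x u.
  by apply: new_cell_mem => //; rewrite -E new_nb // map_f.
by rewrite cx.
Qed.

Lemma new_pos_inj x y : new_member x -> new_member y -> pos x = pos y ->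
  val x = val y.
Proof.
move=> gx gy E; apply: (new_meet gx gy (new_pos gx)).
by rewrite E new_pos.
Qed.

(* Sets of the family are linearly ordered by the position of a single
   boundary point. *)
Definition member z := new_member z \/ core_member z.

(** The set z has one value on the whole fibre of x, and [val_pos] gives this value in the first
    cell. *)
Lemma member_at x z u : new_member x -> member z ->
  pos x != pos z -> u \in T -> val z (x u) = (pos x < pos z).
Proof.
move=> gx hz xz uT; have [_ _ cx _ [ix _]] := gx.
have cz : cells d T z by case: hz => [[_ _ ]|[]].
have xu : x u \in nb (val x) by rewrite new_nb // map_f.
suff -> : val z (x u) = val z (pos x).
  by rewrite (val_pos gx cz) // (pos_cell gx cx).
case: hz => [gz|[_ Cz _]]; last first.
  by case: ix => _ _ h; apply: h => //; exact: new_pos.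
have [_ _ _ _ [[Sz _ _] _]] := gz.
apply: (irr_const Sfin ix Sz _ xu (new_pos gx)) => q qx; apply/negP => qz; case/eqP: xz.
have E := new_meet gx gz qx qz.
have px : pos x \in nb (val z) by rewrite -E new_pos.
by have [_] := new_cell_mem gz px; rewrite (pos_cell gx cx) => <-.
Qed.

Lemma member_cells z : member z -> cells d T z.
Proof. by case=> [[]|[]]. Qed.

Lemma member_sub x z : new_member x -> member z -> pos x < pos z ->
  subb (val x) (val z).
Proof.
move=> gx mz xz; have [sT _ cx _ _] := gx.
apply: (par_cells_cmp (b := true) sT cx (member_cells mz)) => u uT.
by rewrite member_at ?lt_eqF.
Qed.

Lemma member_sup x z : new_member x -> member z -> pos z < pos x ->
  subb (val z) (val x).
Proof.
move=> gx mz zx; have [sT _ cx _ _] := gx.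
apply: (par_cells_cmp (b := false) sT cx (member_cells mz)) => u uT.
by rewrite member_at ?gt_eqF // ltNge ltW.
Qed.

Lemma core_pos x z : new_member x -> core_member z -> pos x != pos z.
Proof.
move=> gx [_ _ oz]; have hT := new_head gx; have [_ _ _ nx _] := gx.
by apply/eqP => E; apply: (nx _ hT); rewrite -/(pos x) E; exact: oz.
Qed.

Lemma core_member_cmp x z : new_member x -> core_member z ->
  subb (val z) (val x) \/ subb (val x) (val z).
Proof.
move=> gx Cz; have [lt|lt|E] := ltgtP (pos x) (pos z).
- by right; apply: member_sub => //; right.
- by left; apply: member_sup => //; right.
- by have := core_pos gx Cz; rewrite E eqxx.
Qed.

Lemma new_chain x z : new_member x -> new_member z ->
  subb (val x) (val z) \/ subb (val z) (val x).
Proof.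
move=> gx gz; have [lt|lt|E] := ltgtP (pos x) (pos z).
- by left; apply: member_sub => //; left.
- by right; apply: member_sup => //; left.
- by rewrite (new_pos_inj gx gz E); left.
Qed.

(** The hull is asked for a set of a finer type, with cells that are small neighbourhoods of the
    boundary points of x; read at depth d, it is a core member close to x. *)
Lemma core_member_between x p q : new_member x -> p < pos x -> pos x < q ->
  exists e, [/\ core_member e, p < pos e & pos e < q].
Proof.
move=> gx px xq; have [n1 h1] := trunc_lt_near px; have [n2 h2] := trunc_gt_near xq.
have [sT oK cx nx [[Sx _ _] _]] := gx; have hT := new_head gx.
pose d' := maxn d (maxn n1 n2).
have dd' : (d <= d')%N by exact: leq_maxl.
pose T' := map (fun u => trunc d' (x u)) T; pose Y v := x (take d v).
have YE u : u \in T -> Y (trunc d' (x u)) = x u.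
  by move=> uT; rewrite /Y take_trunc // cx.
have valY y : par_cells K T' y = val (fun u => y (trunc d' (x u))).
  by rewrite /par_cells -map_comp.
have aY : admissible S d' K T' Y.
  split; first by move=> _ /mapP[u uT ->]; rewrite YE.
  rewrite valY; suff -> : val (fun u => Y (trunc d' (x u))) = val x by [].
  by rewrite /par_cells; congr (par (_ ++ _)); apply/eq_in_map => u uT; exact: YE.
have [y [ay oy _]] := old_le [::] oK aY.
have tr u : u \in T -> trunc d' (y (trunc d' (x u))) = trunc d' (x u).
  by move=> uT; have [cy _] := ay; apply: cy; exact: map_f.
exists (fun u => y (trunc d' (x u))); split.
- split=> [u uT||u _]; last exact: oy.
    by rewrite (trunc_leq dd' (tr u uT)) cx.
  by rewrite -valY; exact: core_cells oK oy ay.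
- by apply: (h1 d'); [rewrite /d' !leq_max leqnn !orbT|exact: tr].
- by apply: (h2 d'); [rewrite /d' !leq_max leqnn !orbT|exact: tr].
Qed.

Definition diff x z w := val z w && ~~ val x w.

Lemma diff_cell x z w : cells d T x -> cells d T z -> diff x z w -> trunc d w \in T.
Proof.
move=> cx cz; apply: contraTT => wT.
by rewrite /diff (par_cells_out K cx cz wT) andbN.
Qed.

Lemma diff_convex x z w l w' : separated d K T -> cells d T x -> cells d T z ->
  w <= l -> l <= w' -> trunc d w = trunc d w' ->
  diff x z w -> diff x z w' -> diff x z l.
Proof.
move=> sT cx cz wl lw' E dw dw'; have wT := diff_cell cx cz dw.
have lE := trunc_convex wl lw' E.
have X1 := par_cells_in sT cx cz wT erefl erefl.
have X2 := par_cells_in sT cx cz wT lE erefl.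
have X3 := par_cells_in sT cx cz wT (esym E) erefl.
have Z1 := par_cells_in sT cx cz wT erefl lE.
have Z2 := par_cells_in sT cx cz wT erefl (esym E).
move: dw dw' X1 X2 X3 Z1 Z2; rewrite /diff.
set u := trunc d w.
have h1 p : (p <= w) ==> (p <= l) by apply/implyP => /le_trans; apply.
have h2 p : (p <= l) ==> (p <= w') by apply/implyP => /le_trans; apply.
move: (h1 (x u)) (h2 (x u)) (h1 (z u)) (h2 (z u)).
by case: (val x w); case: (val z w) => //; case: (val x w'); case: (val z w') => //;
  case: (val x l); case: (val z l) => //; case: (x u <= w); case: (x u <= l);
  case: (x u <= w') => //; case: (z u <= w); case: (z u <= l); case: (z u <= w').
Qed.

Definition free h := exists k, forall y, new_member y ->
  trunc k (pos y) != trunc k h.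

Definition two_sided h := forall k,
  (exists y, [/\ new_member y, trunc k (pos y) = trunc k h & pos y < h]) /\
  (exists y, [/\ new_member y, trunc k (pos y) = trunc k h & h < pos y]).

Definition caught s h := exists e e',
  [/\ core_member e, core_member e', pos e < h /\ h < pos e',
      subb (val e) (val e') &
      forall w w', diff e e' w -> diff e e' w' -> s w = s w'].

(* At a fine point h, the ordering of the family by position is compatible with
   the topology of the Stone space of the core, as far as s can tell. *)
Definition fine s h := free h \/ (two_sided h /\ caught s h).

(** Then h is the infimum of the positions in the cell u, so each of the countably many u has at
    most one such h. *)
Let left_isolated u h := [/\ trunc (size u) h = u, ~ free h &
  forall y, new_member y -> trunc (size u) (pos y) = u -> h <= pos y].

Let right_isolated u h := [/\ trunc (size u) h = u, ~ free h &
  forall y, new_member y -> trunc (size u) (pos y) = u -> pos y <= h].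

Let stuck l h := two_sided h /\ forall y y', new_member y -> new_member y' ->
  pos y < h -> h < pos y' -> diff y y' l.

Lemma not_freeP h k : ~ free h -> exists2 y, new_member y & trunc k (pos y) = trunc k h.
Proof.
move=> nf; apply: contrapT => H; apply: nf; exists k => y gy; apply/eqP => E.
by apply: H; exists y.
Qed.

Lemma left_isolated_inj u h h' : left_isolated u h -> left_isolated u h' -> h = h'.
Proof.
suff H p q : p < q -> left_isolated u p -> left_isolated u q -> False.
  by move=> lh lh'; have [/H|/H|//] := ltgtP h h'; case.
move=> pq [pu nf _] [qu _ hq]; have [n hn] := trunc_gt_near pq.
have [y gy E] := not_freeP (maxn n (size u)) nf.
have /(hq _ gy) : trunc (size u) (pos y) = u.
  by rewrite (trunc_leq (leq_maxr n _) E).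
by rewrite leNgt (hn _ _ (leq_maxl _ _) E).
Qed.

Lemma right_isolated_inj u h h' :
  right_isolated u h -> right_isolated u h' -> h = h'.
Proof.
suff H p q : p < q -> right_isolated u p -> right_isolated u q -> False.
  by move=> lh lh'; have [/H|/H|//] := ltgtP h h'; case.
move=> pq [pu _ hp] [qu nf _]; have [n hn] := trunc_lt_near pq.
have [y gy E] := not_freeP (maxn n (size u)) nf.
have /(hp _ gy) : trunc (size u) (pos y) = u.
  by rewrite (trunc_leq (leq_maxr n _) E).
by rewrite leNgt (hn _ _ (leq_maxl _ _) E).
Qed.

Lemma two_sided_left h p : two_sided h -> p < h ->
  exists y, [/\ new_member y, p < pos y & pos y < h].
Proof.
move=> ts ph; have [n hn] := trunc_lt_near ph; have [[y [gy E yh]] _] := ts n.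
by exists y; split=> //; apply: (hn n).
Qed.

Lemma two_sided_right h p : two_sided h -> h < p ->
  exists y, [/\ new_member y, h < pos y & pos y < p].
Proof.
move=> ts hp; have [n hn] := trunc_gt_near hp; have [_ [y [gy E yh]]] := ts n.
by exists y; split=> //; apply: (hn n).
Qed.

(** Between the two points there are members y' and z' with y' left of z'. Stuck at the left point,
    l is in y'; stuck at the right point, l is not in z', which contains y'. *)
Lemma stuck_inj l h h' : stuck l h -> stuck l h' -> h = h'.
Proof.
suff H p q : p < q -> stuck l p -> stuck l q -> False.
  by move=> lh lh'; have [/H|/H|//] := ltgtP h h'; case.
move=> pq [tp sp] [tq sq].
have [[y [gy _ yp]] _] := tp 0%N; have [_ [z [gz _ qz]]] := tq 0%N.
have [y' [gy' py' y'q]] := two_sided_right tp pq.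
have [z' [gz' y'z' z'q]] := two_sided_left tq y'q.
have /andP[ly' _] := sp y y' gy gy' yp py'.
have /andP[_ /negP] := sq z' z gz' gz z'q qz; apply.
by apply: (member_sub gy' (or_introl gz')).
Qed.

(** The differences shrink as the positions approach h, so finitely many points can be avoided
    simultaneously. *)
Lemma avoid_points h (X : seq lex) : two_sided h -> (forall l, l \in X ->
    exists y y', [/\ new_member y, new_member y', pos y < h, h < pos y' &
      ~~ diff y y' l]) ->
  exists y y', [/\ new_member y, new_member y', pos y < h, h < pos y' &
    {in X, forall l, ~~ diff y y' l}].
Proof.
move=> ts; elim: X => [_|l X IH hX].
  have [[y [gy _ yh]] [y' [gy' _ y'h]]] := ts 0%N; exists y, y'; split=> //.
have [l' l'X|y [y' [gy gy' yh hy' yy']]] := IH.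
  by apply: hX; rewrite inE l'X orbT.
have [z [z' [gz gz' zh hz' zz']]] := hX l (mem_head _ _).
have [t [gt th yt zt]] : exists t, [/\ new_member t, pos t < h,
    subb (val y) (val t) & subb (val z) (val t)].
  have [s|s] := leP (pos y) (pos z).
    exists z; split=> //; move: s; rewrite le_eqVlt => /orP[/eqP E|lt].
      by rewrite (new_pos_inj gy gz E).
    exact: (member_sub gy (or_introl gz)).
  by exists y; split=> //; apply: (member_sub gz (or_introl gy)).
have [t' [gt' ht' ty' tz']] : exists t, [/\ new_member t, h < pos t,
    subb (val t) (val y') & subb (val t) (val z')].
  have [s|s] := leP (pos y') (pos z').
    exists y'; split=> //; move: s; rewrite le_eqVlt => /orP[/eqP E|lt].
      by rewrite (new_pos_inj gy' gz' E).
    exact: (member_sub gy' (or_introl gz')).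
  by exists z'; split=> //; apply: (member_sub gz' (or_introl gy')).
exists t, t'; split=> // l'; rewrite inE => /orP[/eqP ->|l'X].
  by apply: contra zz' => /andP[/tz' a /negP b]; rewrite /diff a; apply/negP => /zt.
by apply: contra (yy' l' l'X) => /andP[/ty' a /negP b]; rewrite /diff a; apply/negP => /yt.
Qed.

Lemma not_fine s h : core s -> ~ fine s h ->
  [\/ exists u, left_isolated u h, exists u, right_isolated u h |
      exists i, stuck (nth lex_zero (bd s) i) h].
Proof.
move=> Cs nf; have nfree : ~ free h by move=> fh; apply: nf; left.
have [ts|nts] := pselect (two_sided h); last first.
  move/existsNP: nts => [k /not_andP[H|H]]; [apply: Or31|apply: Or32];
    exists (trunc k h); split; rewrite ?size_mkseq // => y gy E; rewrite leNgt;
    by apply/negP => lt; apply: H; exists y.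
apply: Or33; apply: contrapT => nst; apply: nf; right; split=> //.
have [|y [y' [gy gy' yh hy' avoid]]] := @avoid_points h (bd s) ts.
  move=> l ls; apply: contrapT => H; apply: nst; exists (index l (bd s)).
  rewrite nth_index //; split=> // y y' gy gy' yh hy'.
  by apply/negPn/negP => dl; apply: H; exists y, y'.
have [t [gt yt th]] := two_sided_left ts yh.
have [t' [gt' ht' ty']] := two_sided_right ts hy'.
have [e [Ce ye eh]] := core_member_between gt yt th.
have [e' [Ce' he' e'y']] := core_member_between gt' ht' ty'.
(* This member carries the value of s from cell to cell: it has a boundary point in each cell of T,
   and the core set s does not separate them. *)
have [b [gb eb bh]] := two_sided_left ts eh.
exists e, e'; split=> //.
  apply: (@subb_trans _ (val b)); first exact: (member_sup gb (or_intror Ce)).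
  by apply: (member_sub gb (or_intror Ce')); exact: lt_trans he'.
have sub w : diff e e' w -> diff y y' w.
  move=> /andP[h1 h2]; apply/andP; split.
    by apply: (member_sup gy' (or_intror Ce')).
  by apply: contra h2; exact: (member_sub gy (or_intror Ce)).
have [sT _ cy _ _] := gy; have [_ _ cy' _ _] := gy'; have [_ _ cb _ [ib _]] := gb.
have yb : pos y < pos b by exact: lt_trans eb.
have by' : pos b < pos y' by apply: (lt_trans bh).
have dbu u : u \in T -> diff y y' (b u).
  move=> uT; rewrite /diff (member_at gb (or_introl gy')) ?lt_eqF // by'.
  by rewrite (member_at gb (or_introl gy)) ?gt_eqF // ltNge (ltW yb).
suff H w : diff y y' w -> s w = s (pos b).
  by move=> w w' /sub dw /sub dw'; rewrite (H w) // (H w').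
move=> dw; have uT := diff_cell cy cy' dw; set u := trunc d w in uT.
have -> : s (pos b) = s (b u).
  have [_ _ h'] := ib; apply: (h' s Cs); first exact: new_pos.
  by rewrite new_nb // map_f.
have Sfs : fin_set s by apply: Sfin; case: Cs.
(* Within a cell the difference is convex and free of boundary points of s, so s is constant
   there. *)
rewrite -(par_bd Sfs) /par; congr odd; apply: eq_in_count => l ls.
apply/idP/idP => lw; rewrite leNgt; apply/negP => lt; have /negP := avoid l ls;
  apply.
- by apply: (diff_convex (w := b u) (w' := w) sT cy cy' (ltW lt) lw);
    [rewrite cb|exact: dbu|].
- by apply: (diff_convex (w := w) (w' := b u) sT cy cy' (ltW lt) lw);
    [rewrite cb|by []|exact: dbu].
Qed.

(* Only countably many points are limits from one side only, and a boundary
   point of s can be stuck at only one point since the family is a chain. *)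
Lemma countable_not_fine s : core s -> countable [set h | ~ fine s h]%classic.
Proof.
move=> Cs; pose B (i : seq bool + seq bool + nat) : set lex :=
  match i with
  | inl (inl u) => [set h | left_isolated u h]%classic
  | inl (inr u) => [set h | right_isolated u h]%classic
  | inr n => [set h | stuck (nth lex_zero (bd s) n) h]%classic
  end.
apply: (countable_subsingletons (B := B)).
  move=> h /(not_fine Cs)[[u hu]|[u hu]|[n hn]].
  - by exists (inl (inl u)).
  - by exists (inl (inr u)).
  - by exists (inr n).
case=> [[u|u]|n] h h' /=; [exact: left_isolated_inj|exact: right_isolated_inj
  |exact: stuck_inj].
Qed.

End TypedFamily.

(** * Compactness of closed subsets of the Cantor space *)

Section Compactness.

Definition lex_closed (H : lex -> Prop) := forall h, ~ H h ->
  exists k, forall z, trunc k z = trunc k h -> ~ H z.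

(** Koenig's lemma: the branch h runs through cells without finite cover, which contradicts the
    local cover if h is in H and closedness otherwise. *)
Lemma lex_compact (I : eqType) (H : lex -> Prop) (O : I -> lex -> Prop) :
  lex_closed H ->
  (forall h, H h -> exists i k, forall z, trunc k z = trunc k h -> O i z) ->
  exists s : seq I, forall z, H z -> exists2 i, i \in s & O i z.
Proof.
move=> cH hO.
pose cov u := exists s : seq I, forall z, H z -> trunc (size u) z = u ->
  exists2 i, i \in s & O i z.
have covS u : cov (rcons u true) -> cov (rcons u false) -> cov u.
  move=> [s hs] [s' hs']; exists (s ++ s') => z Hz zu.
  have E : trunc (size (rcons u (z (size u)))) z = rcons u (z (size u)).
    by rewrite size_rcons /trunc mkseqS -/(trunc _ z) zu.
  case b : (z (size u)) E => E.
    by have [i si Oi] := hs z Hz E; exists i => //; rewrite mem_cat si.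
  by have [i si Oi] := hs' z Hz E; exists i => //; rewrite mem_cat si orbT.
suff [s hs] : cov [::] by exists s => z Hz; exact: hs.
apply: contrapT => ncov.
pose F u := `[< cov (rcons u false) >].
pose g := fix g n := if n is m.+1 then rcons (g m) (F (g m)) else [::].
pose h : lex := fun n => F (g n).
have hg n : trunc n h = g n by elim: n => // n IH; rewrite /trunc mkseqS -/(trunc n h) IH.
have sg n : size (g n) = n by rewrite -hg size_mkseq.
have ng n : ~ cov (g n).
  elim: n => // n IH cn; apply: IH; move: cn; rewrite /= /F.
  by case: asboolP => // cf ct; exact: covS.
have [Hh|nHh] := pselect (H h).
  have [i [k hk]] := hO h Hh; apply: (ng k); exists [:: i] => z _ zk.
  by exists i; [exact: mem_head|apply: hk; rewrite hg; move: zk; rewrite sg].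
have [k hk] := cH h nHh; apply: (ng k); exists [::] => z Hz zk; exfalso.
by apply: (hk z) Hz; rewrite hg; move: zk; rewrite sg.
Qed.

End Compactness.

(** * Families of one type with positions in a closed set *)

Section TypedFamilyClosed.
Local Open Scope order_scope.
Variable S : bset lex -> Prop.
Hypotheses (fS : is_field S) (Sfin : forall a, S a -> fin_set a).
Variables (d : nat) (K : seq lex) (T : seq (seq bool)) (H : lex -> Prop).
Hypothesis cH : lex_closed H.
Implicit Types (a b c s : bset lex) (e x y z : seq bool -> lex)
  (p q w l h : lex) (u v : seq bool) (k : nat).

Local Notation old := (old S).
Local Notation val := (par_cells K T).
Local Notation nb := (nb S).
Local Notation core := (core S).
Local Notation irr := (irr S).
Local Notation pos := (pos T).
Local Notation new_member := (new_member S d K T).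
Local Notation core_member := (core_member S d K T).
Local Notation diff := (diff K T).
Local Notation free := (free S d K T).

Lemma cover (Q : (seq bool -> lex) -> (seq bool -> lex) -> Prop) :
  (forall h, H h -> free h \/ exists e e', [/\ core_member e, core_member e',
     pos e < h /\ h < pos e', subb (val e) (val e') & Q e e']) ->
  exists ps : seq ((seq bool -> lex) * (seq bool -> lex)),
    {in ps, forall r, [/\ core_member r.1, core_member r.2,
      subb (val r.1) (val r.2) & Q r.1 r.2]} /\
    forall y, new_member y -> H (pos y) ->
      exists2 r, r \in ps & pos r.1 < pos y /\ pos y < pos r.2.
Proof.
move=> hH.
pose good (r : (seq bool -> lex) * (seq bool -> lex)) :=
  [/\ core_member r.1, core_member r.2, subb (val r.1) (val r.2) & Q r.1 r.2].
(* The value [None] accounts for neighbourhoods of free points, which contain no position. *)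
pose O (o : option ((seq bool -> lex) * (seq bool -> lex))) w :=
  if o is Some r then good r /\ (pos r.1 < w /\ w < pos r.2)
  else forall y, new_member y -> pos y <> w.
have [|s hs] := @lex_compact _ H O cH.
  move=> h /hH[[k fk]|[e [e' [Ce Ce' [eh he'] sub q]]]].
    exists None, k => w wh y gy E; have := fk y gy.
    by rewrite E wh eqxx.
  have [n1 h1] := trunc_lt_near eh; have [n2 h2] := trunc_gt_near he'.
  exists (Some (e, e')), (maxn n1 n2) => w E; split=> //.
  by split; [apply: h1 E; exact: leq_maxl|apply: h2 E; exact: leq_maxr].
exists [seq r <- pmap id s | `[< good r >]]; split=> [r|y gy Hy].
  by rewrite mem_filter => /andP[/asboolP].
have [[r|] ps Op] := hs _ Hy; last by case: (Op y gy).
have [gp hp] := Op; exists r => //.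
rewrite mem_filter mem_pmap; apply/andP; split; first exact/asboolP.
by apply/mapP; exists (Some r).
Qed.

(** A member squeezed between e and e' can split a class of points with equal values on both only
    inside their difference, where s is constant. *)
Lemma family_resolves s : core s -> (forall h, H h -> fine S d K T s h) ->
  exists es : seq (bset lex), [/\ {in es, forall c, core c},
    {in es, forall c y, new_member y -> subb c (val y) \/ subb (val y) c} &
    forall y, new_member y -> H (pos y) -> forall p q, val y p -> ~~ val y q ->
      {in es, forall c, c p = c q} -> s p = s q].
Proof.
move=> Cs fs.
have [|ps [hps cov]] := @cover (fun e e' =>
    forall w w', diff e e' w -> diff e e' w' -> s w = s w').
  move=> h /fs[fh|[_ [e [e' [Ce Ce' eh sub q]]]]]; first by left.
  by right; exists e, e'.
exists (map (fun r => val r.1) ps ++ map (fun r => val r.2) ps); split.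
- move=> c; rewrite mem_cat => /orP[] /mapP[p /hps[[_ C1 _] [_ C2 _] _ _] ->] //.
- move=> c; rewrite mem_cat => /orP[] /mapP[p /hps[C1 C2 _ _] ->] y gy;
  exact: (core_member_cmp fS Sfin gy).
- move=> y gy Hy p q yp yq E.
  have [[e e'] eps [lt1 lt2]] := cov y gy Hy; have [/= Ce Ce' _ Q] := hps _ eps.
  have s1 := member_sup fS Sfin gy (or_intror Ce) lt1.
  have s2 := member_sub fS Sfin gy (or_intror Ce') lt2.
  have e'p : val e' p by exact: s2.
  have eq : ~~ val e q by apply: contra yq; exact: s1.
  have E1 : val e p = val e q.
    by apply: E; rewrite mem_cat; apply/orP; left; apply/mapP; exists (e, e').
  have E2 : val e' p = val e' q.
    by apply: E; rewrite mem_cat; apply/orP; right; apply/mapP; exists (e, e').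
  by apply: Q; rewrite /diff ?E1 -?E2 e'p eq.
Qed.

(* If no core set separates a from the closed part of the family, compactness
   gives a point h of H with the same core neighbourhoods as a. Members of the
   family converge to h from both sides, and comparing a with them shows that
   its new boundary points have one representative in each cell, with the
   orientation of the family up to complement. Gluing a between two core
   members thus gives a member with the same new boundary points. *)
Lemma family_apart a : irr a ->
  (forall s h, core s -> H h -> fine S d K T s h) ->
  (exists y, [/\ new_member y, H (pos y) & nb (val y) =i nb a]) \/
  (exists c, [/\ core c, {in nb a, forall q, c q} &
    forall y, new_member y -> H (pos y) -> const_on c (val y)]).
Proof.
move=> ia hfine; have [Sa [p0 p0a] ha] := ia.
have Sval e : core_member e -> core (val e) by case.
have [hall|] := pselect (forall h, H h -> free h \/ exists e e',
  [/\ core_member e, core_member e', pos e < h /\ h < pos e',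
      subb (val e) (val e') & ~~ diff e e' p0]).
  right; have [ps [hps cov]] := @cover (fun e e' => ~~ diff e e' p0) hall.
  (* The atom of p0 for the finitely many core members of the cover. As p0 is outside every
     difference, a set squeezed between such a pair is constant on this atom. *)
  pose c w := all (fun r => (val r.1 w == val r.1 p0) &&
    (val r.2 w == val r.2 p0)) ps.
  exists c; split.
  - apply: (@field_determined _ _
      (map (fun r => val r.1) ps ++ map (fun r => val r.2) ps)).
    + exact: core_field.
    + by move=> s; rewrite mem_cat => /orP[] /mapP[r /hps[C1 C2 _ _] ->];
        exact: Sval.
    + move=> w w' E; apply: eq_in_all => r rps.
      by rewrite !E // mem_cat; apply/orP; [right|left]; apply/mapP; exists r.
  - move=> q qa; apply/allP => r /hps[C1 C2 _ _].
    by rewrite !(ha _ (Sval _ _) q p0) ?eqxx.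
  - move=> y gy Hy w w' /allP cw /allP cw'.
    have [r rps [lt1 lt2]] := cov y gy Hy; have [C1 C2 _ ndiff] := hps r rps.
    have s1 := member_sup fS Sfin gy (or_intror C1) lt1.
    have s2 := member_sub fS Sfin gy (or_intror C2) lt2.
    have /andP[/eqP e1 /eqP e2] := cw r rps.
    have /andP[/eqP e1' /eqP e2'] := cw' r rps.
    move: ndiff; rewrite negb_and negbK => /orP[n2|n1].
      transitivity false; [|symmetry]; apply/negbTE; apply: contra n2 => /s2;
        by rewrite ?e2 ?e2'.
    by rewrite !s1 ?e1 ?e1'.
move=> /existsNP[h /not_implyP[Hh /not_orP[nfree hdiff]]].
(* Differences around h contain p0 and, being core sets, the whole fibre of a. *)
have around e e' : core_member e -> core_member e' -> pos e < h -> h < pos e' ->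
    subb (val e) (val e') -> forall q, q \in nb a -> diff e e' q.
  move=> Ce Ce' eh he' sub q qa; rewrite /diff (ha _ (Sval _ Ce') q p0) //.
  rewrite (ha _ (Sval _ Ce) q p0) //; apply/negPn/negP => nd.
  by apply: hdiff; exists e, e'.
have hf s : core s -> two_sided S d K T h /\ caught S d K T s h.
  by move=> Cs; have [] := hfine s h Cs Hh.
have [d1 [K1 [T1 [y0 [r inj]]]]] := rep_deep Sfin [:: h] Sa.
have [p0T _] := rep_mem r p0a.
have [y1 [y2 [cy1 cy2 Cy1 Cy2 [lt1 lt2]]]] := rep_approx Sa r p0T.
have [_ yp0] := rep_mem r p0a; rewrite yp0 in lt1 lt2.
have [sT1 _ aE cy0 nE] := r.
pose c w := par_cells K1 T1 y1 w (+) par_cells K1 T1 y2 w.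
have Cc : core c by apply: fieldX => //; exact: core_field.
have cE w : c w = (trunc d1 w \in T1) &&
    ((y1 (trunc d1 w) <= w) (+) (y2 (trunc d1 w) <= w)).
  exact: par_cells_xor.
have cp0 : c p0 by rewrite cE p0T (ltW lt1) leNgt lt2.
have [ts [e [e' [Ce Ce' [eh he'] sub cc]]]] := hf c Cc.
have Dnb := around e e' Ce Ce' eh he' sub.
have Dc w : diff e e' w -> c w by move=> dw; rewrite (cc w p0) // Dnb.
have [b [gb eb bh]] := two_sided_left ts eh.
have [b' [gb' hb' b'e']] := two_sided_right ts he'.
have [sT oK cb nbo [ib _]] := gb; have [_ _ cb' _ [ib' _]] := gb'.
have ce : cells d T e by case: Ce.
have ce' : cells d T e' by case: Ce'.
have hT := new_head gb; set hd := head [::] T in hT.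
have hhd : trunc d h = hd.
  rewrite (trunc_convex (ltW eh) (ltW he')) ?(pos_cell gb ce) //.
  by rewrite (pos_cell gb ce').
have Dh : diff e e' h.
  rewrite /diff (val_pos gb ce') // he'.
  by rewrite (val_pos gb ce) // -leNgt ltW.
have T1D w : diff e e' w -> trunc d1 w \in T1.
  by move=> /Dc; rewrite cE => /andP[].
have nby0 v : v \in T1 -> y0 v \in nb a by move=> vT; rewrite -nE map_f.
(* The neighbourhood c of p0 lies in the cells of nb a, and it contains h because the difference
   around h is inside c; at this depth h must be a point of nb a. *)
have ha' : h \in nb a.
  suff -> : h = y0 (trunc d1 h) by apply/nby0/T1D.
  have hb := nby0 _ (T1D h Dh).
  apply: inj; rewrite ?mem_head ?cy0 ?T1D //.
  by move: hb => /mem_nb[hb _]; rewrite inE hb orbT.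
have bb' : pos b < pos b' by exact: lt_trans hb'.
(* A member that meets the fibre of a has the same fibre and the position h, so it is as wanted.
   Otherwise one has to be glued. *)
have [[y [gy [q [qy qa]]]]|disj] := pselect (exists y, new_member y /\
    exists q, q \in nb (val y) /\ q \in nb a).
  left; have [_ _ _ _ [iy _]] := gy.
  have E := irr_eq fS Sfin iy ia qy qa; exists y; split=> //.
  suff -> : pos y = h by [].
  have hy : h \in nb (val y) by rewrite E.
  by have [_] := new_cell_mem gy hy; rewrite hhd.
have disj' y q : new_member y -> q \in nb (val y) -> q \notin nb a.
  by move=> gy qy; apply/negP => qa; apply: disj; exists y; split=> //; exists q.
have ab y u : new_member y -> u \in T -> a (y u) = a (pos y).
  move=> gy uT; have [_ _ cy _ [iy _]] := gy.
  apply: (irr_const Sfin iy Sa (fun q => disj' y q gy) _ (new_pos gy)).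
  by rewrite (new_nb gy) map_f.
have Dnew y u : new_member y -> pos e < pos y -> pos y < pos e' -> u \in T ->
    diff e e' (y u).
  move=> gy ey ye' uT; rewrite /diff.
  rewrite (member_at fS Sfin gy (or_intror Ce')) ?(lt_eqF ye') // ye'.
  by rewrite (member_at fS Sfin gy (or_intror Ce)) ?(gt_eqF ey) // -leNgt ltW.
have Db u : u \in T -> diff e e' (b u).
  by apply: Dnew => //; apply: lt_trans he'.
have Db' u : u \in T -> diff e e' (b' u).
  by apply: Dnew => //; apply: lt_trans hb'.
(* Between points of two different cells of depth d1 there would be the larger of y1 v and y2 v,
   which is not in c. *)
have onecell w w' : diff e e' w -> diff e e' w' -> trunc d w = trunc d w' ->
    trunc d1 w = trunc d1 w'.
  suff lem t t' : t < t' -> diff e e' t -> diff e e' t' ->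
      trunc d t = trunc d t' -> trunc d1 t = trunc d1 t'.
    move=> dw dw' E; have [lt|lt|->//] := ltgtP w w'; first exact: lem.
    by apply/esym/lem.
  move=> tt' dt dt' E; apply/eqP/negPn/negP => nE1.
  have ct := Dc t dt; move: (ct); rewrite cE => /andP[vT].
  set v := trunc d1 t in vT nE1 *.
  pose m := Order.max (y1 v) (y2 v).
  have mv : trunc d1 m = v by rewrite /m; case: leP => _; rewrite ?cy1 ?cy2.
  move=> tb; have tm : t < m.
    by rewrite /m lt_max !ltNge; move: tb; case: (_ <= _); case: (_ <= _).
  have mt' : m < t' by exact: (trunc_lt tt' nE1).
  have : c m.
    by apply/Dc/(diff_convex sT ce ce' (ltW tm) (ltW mt') E dt dt').
  by rewrite cE mv vT /m !le_max !lexx orbT.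
(* The point of nb a that is to be the boundary point in the cell u. *)
pose Q u := y0 (trunc d1 (b u)).
have Qa u : u \in T -> Q u \in nb a by move=> uT; apply/nby0/T1D/Db.
have Qcell w u : diff e e' w -> u \in T -> trunc d w = u ->
    trunc d1 w = trunc d1 (b u).
  by move=> dw uT wu; apply: onecell => //; [exact: Db|rewrite cb].
have acell w u : diff e e' w -> u \in T -> trunc d w = u ->
    a w (+) (Q u <= w) = a (pos b) (+) (Q u <= b u).
  move=> dw uT wu; rewrite -(ab b u gb uT) aE.
  exact: (par_cells_in sT1 cy0 cy0 (T1D _ (Db u uT)) (Qcell w u dw uT wu) erefl).
have Qhd : Q hd = h.
  rewrite /Q -(Qcell h hd Dh hT hhd).
  by have [_] := rep_mem r ha'.
(* The members b and b' are on opposite sides of h, and a is constant on the fibre of each; so a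
   changes between b u and b' u in every cell u, which puts Q u between them. *)
have ab' : a (pos b') = ~~ a (pos b).
  have := acell (pos b') hd (Db' hd hT) hT (cb' _ hT).
  rewrite Qhd (ltW hb') leNgt -/(pos b) bh.
  by case: (a (pos b')); case: (a (pos b)).
have Qsep u : u \in T -> (Q u <= b u) != (Q u <= b' u).
  move=> uT; have := acell (b' u) u (Db' u uT) uT (cb' _ uT).
  rewrite (ab b' u gb' uT) ab'.
  by case: (a (pos b)); case: (Q u <= b u); case: (Q u <= b' u).
have Qd u : u \in T -> trunc d (Q u) = u.
  move=> uT; have := Qsep u uT; have [|lt] := leP (Q u) (b u).
    move=> le; rewrite eq_sym eqb_id -ltNge => lt.
    by rewrite (trunc_convex (ltW lt) le) ?cb' ?cb.
  have [le|] := leP (Q u) (b' u); last by [].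
  by rewrite (trunc_convex (ltW lt) le) ?cb' ?cb.
have Qb' u : u \in T -> (Q u <= b u) = (b' u <= b u).
  move=> uT; have := Qsep u uT; have [le|lt] := leP (Q u) (b u).
    rewrite eq_sym eqb_id -ltNge => lt; apply/esym/ltW; exact: lt_le_trans le.
  have [le _|//] := leP (Q u) (b' u); apply/esym/negbTE; rewrite -ltNge.
  exact: lt_le_trans le.
pose D := bsetI (val e') (bsetC (val e)).
(* Complementing if needed gives a the orientation of the family; the glued set is X inside the
   difference and e outside. *)
pose X := if a (pos b) then a else bsetC a.
have valQ w : val Q w = if diff e e' w then X w else val e w.
  have cQ : cells d T Q by [].
  have [wT|wT] := boolP (trunc d w \in T); last first.
    rewrite ifN; first exact: (par_cells_out _ cQ ce wT).
    by apply: contra wT; exact: diff_cell.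
  set u := trunc d w in wT.
  have vb' : val b' (b u) = true.
    by rewrite (member_at fS Sfin gb (or_introl gb')) ?(lt_eqF bb').
  case: ifP => dw.
    have := par_cells_in sT cQ cb' wT (erefl : trunc d w = u) (cb u wT).
    rewrite vb' -(Qb' u wT); have := acell w u dw wT erefl.
    rewrite /X; case: (a (pos b)); rewrite /bsetC; case: (a w);
      case: (val Q w); by case: (Q u <= w); case: (Q u <= b u).
  have DQ := Dnb _ (Qa u wT).
  have E1 := par_cells_in sT cQ ce wT (erefl : trunc d w = u) (Qd u wT).
  have E2 := par_cells_in sT ce ce' wT (Qd u wT) (Qd u wT).
  have E3 := par_cells_in sT ce ce' wT (erefl : trunc d w = u) (Qd u wT).
  have E4 := par_cells_in sT ce' ce' wT (erefl : trunc d w = u) (Qd u wT).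
  have S1 := sub w.
  have L p : (p <= Q u) ==> (Q u <= w) ==> (p <= w).
    by apply/implyP => pQ; apply/implyP; exact: le_trans.
  have L' p : (p <= w) ==> ~~ (Q u <= w) ==> (p <= Q u).
    by apply/implyP => pQ; apply/implyP; rewrite -ltNge => /ltW; exact: le_trans.
  move: DQ dw E1 E2 E3 E4 (L (e u)) (L (e' u)) (L' (e u)) (L' (e' u)) S1.
  rewrite /diff; case: (val e' (Q u)) => //; case: (val e (Q u)) => // _.
  by case: (val e' w); case: (val e w) => //; case: (val Q w) => //;
    case: (Q u <= w); case: (e u <= Q u); case: (e' u <= Q u); case: (e u <= w);
    case: (e' u <= w) => //= _ _ _ _ _ _ _ _ _ /(_ isT).
have SQ : S (val Q).
  have [_ SC SI] := fS.
  have Se : S (val e) by case: (Sval _ Ce).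
  have Se' : S (val e') by case: (Sval _ Ce').
  have SX : S X by rewrite /X; case: ifP => _ //; exact: SC.
  have -> : val Q = bsetU (bsetI D X) (bsetI (bsetC D) (val e)).
    apply: bsetP => w; rewrite valQ /bsetU /bsetI /D /bsetC /bsetI /diff.
    by case: (val e' w); case: (val e w); case: (X w).
  have SD : S D by apply: (SI) => //; exact: SC.
  by apply: fieldU => //; [exact: SI|apply: (SI) => //; exact: SC].
have Qold : {in T, forall u, ~ old (Q u)} by move=> u /Qa/mem_nb[].
have nbQ := nb_par_cells sT oK Qd Qold.
have iQ : irr (val Q).
  split=> //; first by exists (Q hd); rewrite nbQ map_f.
  move=> s Cs p q; rewrite !nbQ => /mapP[u uT ->] /mapP[v vT ->].
  by apply: (ha s Cs); exact: Qa.
left; exists Q; split.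
- split=> //; split=> //; rewrite (val_pos gb Qd) ?ltxx //.
  exact: Qd.
- by rewrite /pos -/hd Qhd.
- by apply: (irr_eq fS Sfin iQ ia _ ha'); rewrite nbQ -Qhd map_f.
Qed.

End TypedFamilyClosed.

(* L is a lambda'-set: every countable P is a relative G_delta in L union P. *)
Definition lambda_prime (L : lex -> Prop) := forall P : set lex, countable P ->
  exists H : nat -> lex -> Prop, [/\ forall j, lex_closed (H j),
    forall j z, H j z -> ~ P z & forall l, L l -> ~ P l -> exists j, H j l].

(** * Verification of the hypotheses of the fusion *)

Section Assembly.
Local Open Scope order_scope.
Variables (L : lex -> Prop) (S : bset lex -> Prop).
Hypotheses (lambdaL : lambda_prime L) (fS : is_field S).
Hypothesis Sfin : forall a, S a -> fin_set a.
Hypothesis SL : forall a, S a -> {in bd a, forall p, L p}.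
Implicit Types (a b c s : bset lex) (e x y z : seq bool -> lex)
  (p q w l h : lex) (u v : seq bool) (j k m n : nat).

Local Notation nb := (nb S).
Local Notation core := (core S).
Local Notation irr := (irr S).

Lemma core_cut a c : irr a -> core c -> {in nb a, forall q, c q} ->
  core (bsetI a (bsetC c)).
Proof.
move=> [Sa _ _] Cc ac; have [_ CC _] := core_field fS Sfin; have [_ _ SI] := fS.
have CCc := CC _ Cc; apply: core_nb => [|p]; first by apply: SI => //; case: CCc.
rewrite nbI //; apply/negP => /andP[pa]; rewrite /bsetC ac //.
Qed.

Lemma singleton_resolves a s : irr a -> core s -> exists es : seq (bset lex),
  [/\ {in es, forall c, core c}, {in es, forall c, subb c a \/ subb a c} &
    forall p q, a p -> ~~ a q -> {in es, forall c, c p = c q} -> s p = s q].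
Proof.
move=> ia; wlog [q0 q0a sq0] : s / exists2 q, q \in nb a & s q.
  move=> hw Cs; have [_ [q qa] _] := ia; have [_ CC _] := core_field fS Sfin.
  have [sq|sq] := boolP (s q); first by apply: hw => //; exists q.
  have [||es [h1 h2 h3]] := hw (bsetC s); [by exists q|exact: CC|].
  exists es; split=> // p r ap ar E; have := h3 p r ap ar E.
  by rewrite /bsetC; case: (s p); case: (s r).
move=> Cs; have [Sa _ ha] := ia.
have sa : {in nb a, forall q, s q} by move=> q qa; rewrite (ha s Cs q q0).
have [_ CC _] := core_field fS Sfin.
exists [:: bsetI a (bsetC s); bsetC (bsetI (bsetC a) (bsetC s))]; split.
- move=> c; rewrite !inE => /orP[/eqP ->|/eqP ->]; first exact: core_cut.
  apply/CC/core_cut => //; first exact: irrC.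
  by move=> q; rewrite nbC //; exact: sa.
- move=> c; rewrite !inE => /orP[/eqP ->|/eqP ->]; [left|right] => w.
    by case/andP.
  by rewrite /bsetC /bsetI => ->.
- move=> p q ap aq E.
  have := E (bsetI a (bsetC s)); rewrite !inE eqxx => /(_ isT).
  have := E (bsetC (bsetI (bsetC a) (bsetC s))); rewrite !inE eqxx orbT => /(_ isT).
  by rewrite /bsetC /bsetI ap (negbTE aq); case: (s p); case: (s q).
Qed.

(** A core neighbourhood of the fibre of a that misses the fibre of b has core traces on b and on
    its complement; one of the traces is the set wanted. *)
Lemma singleton_apart a b : irr a -> irr b -> ~ (nb b =i nb a) ->
  exists c, [/\ core c, {in nb a, forall q, c q} & const_on c b].
Proof.
move=> ia ib ba; have [Sa [p pa] ha] := ia; have [Sb _ _] := ib.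
have ab q : q \in nb a -> q \notin nb b.
  move=> qa; apply/negP => qb; apply: ba; exact: (irr_eq fS Sfin ib ia qb qa).
have [c [Cc cp cb]] := nb_neighbourhood fS Sfin (nb b) Sa pa.
have ca : {in nb a, forall q, c q} by move=> q qa; rewrite (ha c Cc q p).
have ncb : {in nb b, forall q, bsetC c q}.
  move=> q qb; apply/negP => cq; have /negP := ab q (cb q qb cq); exact.
have hb := irr_const Sfin ia Sb ab.
have [_ CC CI] := core_field fS Sfin.
have cbb b' : irr b' -> {in nb b', forall q, bsetC c q} -> core (bsetI b' c).
  move=> ib' h; have := core_cut ib' (CC _ Cc) h.
  by congr core; apply: bsetP => w; rewrite /bsetI /bsetC negbK.
have [bp|bp] := boolP (b p).
  exists (bsetI b c); split; [exact: cbb| |].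
    by move=> q qa; rewrite /bsetI ca // (hb q p qa pa) bp.
  by move=> w w' /andP[-> _] /andP[-> _].
exists (bsetI (bsetC b) c); split; [apply: cbb; first exact: irrC| |].
- by move=> q; rewrite nbC //; exact: ncb.
- by move=> q qa; rewrite /bsetI ca // /bsetC (hb q p qa pa) bp.
- by move=> w w' /andP[/negbTE -> _] /andP[/negbTE -> _].
Qed.

(** The normalisation may require the complement, which toggles [lex_zero] in the boundary; hence
    the depth also has to separate [lex_zero] from the new points. *)
Lemma irr_new_member a : irr a -> exists d ts T y,
  new_member S d (map (hull S) ts) T y /\
  nb (par_cells (map (hull S) ts) T y) =i nb a.
Proof.
move=> ia; have [Sa [p pa] _] := ia.
have [d [K [T [y [r inj]]]]] := rep_deep Sfin [:: lex_zero] Sa.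
have [[uT KT] oK aE cy nE] := r.
have ny : {in T, forall u, ~ old S (y u)}.
  move=> u uT'; have : y u \in nb a by rewrite -nE map_f.
  by move=> /mem_nb[].
have [nv|v] := boolP (a (pos T y)); last first.
  have [ts KE] := old_seq oK; exists d, ts, T, y; rewrite -KE -aE; split=> //.
  by split=> //; split; rewrite -aE //; exact: negbTE.
have aE' : bsetC a = par_cells (lex_zero :: K) T y by rewrite aE parC.
have oK' : {in lex_zero :: K, forall q, old S q}.
  by move=> k; rewrite inE => /orP[/eqP ->|/oK //]; exact: old0.
have [ts KE] := old_seq oK'; exists d, ts, T, y; rewrite -KE -aE'; split.
  split=> //; last by rewrite -aE' /bsetC nv; split=> //; exact: irrC.
  split=> // k; rewrite inE => /orP[/eqP ->|/KT //]; apply/negP => zT.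
  have yz : y (trunc d lex_zero) \in nb a by rewrite -nE map_f.
  have [yb no] : y (trunc d lex_zero) \in bd a /\ ~ old S (y (trunc d lex_zero)).
    exact/mem_nb.
  apply: no; rewrite (_ : y _ = lex_zero); first exact: old0.
  by apply: inj; rewrite ?mem_head ?inE ?yb ?orbT // cy.
by move=> q; rewrite nbC.
Qed.

(* The points that are not fine form a countable set P. Irreducible sets
   positioned in P are treated one by one; the other ones lie in families
   restricted to closed sets avoiding P. *)
Lemma subalgebra_chain : exists C : bset lex -> Prop,
  [/\ is_chain C, forall c, C c -> S c & forall a, S a -> gen C a].
Proof.
have [e0 [e0C e0S]] := core_enum fS Sfin.
pose K ts := map (hull S) ts.
pose tcode : countType := (nat * seq (GenTree.tree bool) * seq (seq bool) * nat)%type.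
pose bad (t : tcode) : set lex :=
  [set h | ~ fine S t.1.1.1 (K t.1.1.2) t.1.2 (e0 t.2) h]%classic.
pose P := (\bigcup_(t in [set: tcode]) bad t)%classic.
have cP : countable P.
  by apply: bigcup_countable => // t _; exact: countable_not_fine.
have [H [cH HP HL]] := lambdaL cP.
have fineH d ts T j s h : core s -> H j h -> fine S d (K ts) T s h.
  move=> /e0S[n <-] Hh; apply: contrapT => nf; apply: (HP j h Hh).
  by exists (d, ts, T, n).
have /countable_injP[f finj] := cP.
(* By injectivity of f, the code n determines p and so the fibre of b. *)
pose sing n b := irr b /\ exists p, [/\ P p, f p = n & p \in nb b].
have /choice[sb hsb] : forall n, exists b, (exists b', sing n b') -> sing n b.
  move=> n; have [[b hb]|nb'] := pselect (exists b', sing n b'); first by exists b.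
  by exists (@bset0 lex).
pose G (i : tcode + nat) b := match i with
  | inl t => exists y, [/\ new_member S t.1.1.1 (K t.1.1.2) t.1.2 y,
      H t.2 (pos t.1.2 y) & b = par_cells (K t.1.1.2) t.1.2 y]
  | inr n => sing n b /\ b = sb n end.
pose Gm m b := if unpickle m is Some i then G i b else False.
have Girr m b : Gm m b -> irr b.
  rewrite /Gm; case: unpickle => [[t|n]|] //=; last by case=> [[ib _] _].
  by move=> [y [[_ _ _ _ [iy _]] _ ->]].
have Gchain m : is_chain (Gm m).
  rewrite /Gm; case: unpickle => [[t|n]|] a b //=.
    by move=> [y [gy _ ->]] [z [gz _ ->]]; exact: (new_chain fS Sfin gy gz).
  by move=> [_ ->] [_ ->]; left.
have Gres m s : core s -> exists es : seq (bset lex),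
    [/\ {in es, forall c, core c},
        {in es, forall c a, Gm m a -> subb c a \/ subb a c} &
        forall a, Gm m a -> forall p q, a p -> ~~ a q ->
        {in es, forall c, c p = c q} -> s p = s q].
  move=> Cs; rewrite /Gm; case: unpickle => [[t|n]|]; last by exists [::].
    have [|es [h1 h2 h3]] := @family_resolves _ fS Sfin t.1.1.1 (K t.1.1.2) t.1.2
      (H t.2) (cH _) s Cs; first by move=> h; exact: fineH.
    exists es; split=> // [c ces a [y [gy _ ->]]|a [y [gy Hy ->]]]; first exact: h2.
    exact: h3.
  have [[b [ib _]]|ns] := pselect (exists b, sing n b /\ b = sb n); last first.
    by exists [::]; split=> // a ha; exfalso; apply: ns; exists a.
  have [ia E] : irr (sb n) /\ True by have [[]] : sing n (sb n) by apply: hsb; exists b.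
  have [es [h1 h2 h3]] := singleton_resolves ia Cs; exists es; split=> //.
    by move=> c ces a [_ ->]; exact: h2.
  by move=> a [_ ->]; exact: h3.
have Gapart m a : irr a -> (exists b, Gm m b /\ nb b =i nb a) \/
    exists c, [/\ core c, {in nb a, forall q, c q} &
      forall b, Gm m b -> const_on c b].
  move=> ia; rewrite /Gm; case: unpickle => [[t|n]|]; last first.
  - right; exists (@bsetT lex); split=> //; exact: fieldT (core_field fS Sfin).
  - have [h|nh] := pselect (sing n (sb n) /\ nb (sb n) =i nb a).
      by left; exists (sb n); case: h.
    right; have [hs|ns] := pselect (sing n (sb n)); last first.
      exists (@bsetT lex); split=> // [|b [hb E]]; first exact: fieldT (core_field fS Sfin).
      by case: ns; rewrite -E.
    have [ib _] := hs; have [c [h1 h2 h3]] := singleton_apart ia ib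
      (fun E => nh (conj hs E)).
    by exists c; split=> // b [_ ->].
  - have [|[y [gy Hy E]]|[c [h1 h2 h3]]] := @family_apart _ fS Sfin t.1.1.1
      (K t.1.1.2) t.1.2 (H t.2) (cH _) a ia.
    + by move=> s h; exact: fineH.
    + left; exists (par_cells (K t.1.1.2) t.1.2 y); split=> //.
      by exists y.
    + by right; exists c; split=> // b [y [gy Hy ->]]; exact: h3.
have Gonto a : irr a -> exists m, `[< exists b, Gm m b /\ nb b =i nb a >].
  move=> /irr_new_member[d [ts [T [y [gy E]]]]].
  have [_ _ _ _ [iy _]] := gy; have py := new_pos gy.
  have Ly : L (pos T y).
    by have [Sy _ _] := iy; apply: (SL Sy); move: py => /mem_nb[].
  have [Pp|nPp] := pselect (P (pos T y)).
    exists (pickle (inr (f (pos T y)) : tcode + nat)%type); apply/asboolP.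
    rewrite /Gm pickleK.
    have hs : sing (f (pos T y)) (sb (f (pos T y))).
      by apply: hsb; exists (par_cells (K ts) T y); split=> //; exists (pos T y).
    exists (sb (f (pos T y))); split=> // q.
    have [ib [p [Pq fp pb]]] := hs.
    have Epq : p = pos T y by apply: finj; rewrite ?inE.
    by rewrite Epq in pb; rewrite -E; exact: (irr_eq fS Sfin ib iy pb py).
  have [j Hj] := HL _ Ly nPp.
  exists (pickle (inl (d, ts, T, j) : tcode + nat)%type); apply/asboolP.
  rewrite /Gm pickleK; exists (par_cells (K ts) T y); split=> //.
  by exists y.
(* A fibre is kept only in the first family that has it, since no core set separates sets with the
   same fibre. *)
pose G' m b := Gm m b /\ forall j, (j < m)%N -> ~ exists b', Gm j b' /\ nb b' =i nb b.
apply: (@fusion lex S core G' e0) => //.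
- exact: core_field.
- by move=> a [].
- by move=> m a [/Girr[]].
- by move=> m a b [Ga _] [Gb _]; exact: Gchain Ga Gb.
- move=> a /(irr_gen fS Sfin); apply: gen_field; first exact: gen_is_field.
  move=> {}a [Ca|ia]; first by apply: gen_in; left.
  have [m /asboolP[b [Gb E]] minm] := ex_minnP (Gonto a ia).
  have [Sa _ _] := ia; have [Sb _ _] := Girr _ _ Gb.
  (* Sets with the same fibre differ by a core set. *)
  have -> : a = (fun w => b w (+) (a w (+) b w)).
    by apply: bsetP => w; case: (a w); case: (b w).
  apply: fieldX; first exact: gen_is_field.
    apply: gen_in; right; exists m; split=> // j jm [b' [Gb' E']].
    have : (m <= j)%N.
      by apply: minm; apply/asboolP; exists b'; split=> // q; rewrite E'.
    by rewrite leqNgt jm.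
  apply: gen_in; left; apply: core_xor => // q; by rewrite E.
- move=> m s /(Gres m)[es [h1 h2 h3]]; exists es; split=> //.
    by move=> e ee a [Ga _]; exact: h2.
  by move=> a [Ga _]; exact: h3.
- move=> j m a jm [Ga na]; have ia := Girr _ _ Ga.
  have [h|[c [h1 h2 h3]]] := Gapart j a ia; first by case: (na j jm).
  exists c; split=> //; first exact: core_cut.
  by move=> b [Gb _]; exact: h3.
Qed.

End Assembly.

(** * A Hausdorff gap *)

Lemma infinite_injection U (A : set U) : infinite_set A ->
  exists f : nat -> U, injective f /\ forall n, A (f n).
Proof.
elim/Ppointed: U => U in A *; first by rewrite emptyE.
move=> /infiniteP/pcard_leP[f]; exists f; split; last by move=> n; exact: funS.
by move=> m n; apply: 'inj_f; rewrite in_setE.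
Qed.

Section TransfiniteRecursion.
Variables (W : Type) (lt : W -> W -> Prop) (X : Type) (x0 : X).
Hypothesis lt_wf : well_founded lt.
Variable R : (W -> X) -> W -> X -> Prop.
Hypothesis R_local : forall f g w x, (forall v, lt v w -> f v = g v) ->
  R f w x -> R g w x.
Hypothesis R_step : forall f w, (forall v, lt v w -> R f v (f v)) ->
  exists x, R f w x.

(** Functions on initial segments are extended by the default x0, and [R_local] transfers R between
    such an extension and the total function. *)
Lemma transfinite_recursion : exists f, forall w, R f w (f w).
Proof.
pose ext w (rec : forall v, lt v w -> X) v :=
  if pselect (lt v w) is left h then rec v h else x0.
pose F w (rec : forall v, lt v w -> X) :=
  if pselect (exists x, R (ext w rec) w x) is left h then projT1 (cid h) else x0.
pose f := Fix lt_wf (fun=> X) F.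
have fE w : f w = F w (fun v _ => f v).
  apply: (Fix_eq lt_wf (fun=> X) F) => v g h gh.
  by congr F; apply: functional_extensionality_dep => u; apply: funext => p; exact: gh.
exists f => w; elim: (lt_wf w) => {}w _ IH.
have extf v : lt v w -> ext w (fun v _ => f v) v = f v.
  by move=> vw; rewrite /ext; case: pselect.
rewrite fE /F; case: pselect => [h|nh].
  by case: cid => x /= Rx; apply: R_local Rx.
exfalso; apply: nh; have [x Rx] := R_step IH; exists x.
by apply: R_local Rx => v /extf.
Qed.

End TransfiniteRecursion.

Record omega1_like (W : eqType) (lt : W -> W -> Prop) : Prop := Omega1Like {
  omega1_wf : well_founded lt;
  omega1_trans : forall u v w, lt u v -> lt v w -> lt u w;
  omega1_tri : forall v w, [\/ lt v w, v = w | lt w v];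
  omega1_irr : forall w, ~ lt w w;
  omega1_seg : forall w, countable [set v | lt v w]%classic;
  omega1_uncountable : ~ countable [set: W]
}.

Lemma lex_uncountable : ~ countable [set: lex].
Proof.
move=> /countable_injP[g ginj].
pose d : lex := fun n => `[< forall x, g x = n -> ~~ x n >].
have dE : d (g d) = ~~ d (g d); last by case: (d (g d)) dE.
apply/asboolP/idP => [h|nd x gx]; first exact: h.
by rewrite (ginj x d) ?inE.
Qed.

Local Open Scope classical_set_scope.

(** A well-order of the Cantor space, cut at the first point with uncountably many predecessors if
    there is one. *)
Lemma omega1_exists : exists (W : eqType) (lt : W -> W -> Prop), omega1_like lt.
Proof.
have [R woR] := wochoice.well_ordering_principle lex.
have min (A : set lex) : A !=set0 -> exists m, A m /\ forall x, A x -> R m x.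
  move=> [a Aa]; have [|m [[mA mlb] _]] := woR [pred x | `[< A x >]].
    by exists a; apply/asboolP.
  by exists m; split=> [|x Ax]; [apply/asboolP|apply/mlb/asboolP].
have Rxx x : R x x.
  by have [|m [-> h]] := min [set x]%classic; [exists x|exact: h].
have Ranti x y : R x y -> R y x -> x = y.
  move=> xy yx; have [|m [_ mu]] := woR (pred2 x y).
    by exists x; rewrite inE eqxx.
  rewrite -(mu x) ?(mu y) //; split; rewrite ?inE ?eqxx ?orbT // => z;
    by rewrite inE => /orP[] /eqP ->.
pose lt x y := ~~ R y x.
have tri x y : [\/ lt x y, x = y | lt y x].
  have [yx|] := boolP (R y x); last by constructor 1.
  have [xy|] := boolP (R x y); last by constructor 3.
  by constructor 2; exact: Ranti.
have trans x y z : lt x y -> lt y z -> lt x z.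
  move=> xy yz; apply/negP => zx.
  have [|m [Am h]] := min [set x; y; z]%classic; first by exists x; left; left.
  have hx : R m x by apply: h; left; left.
  have hy : R m y by apply: h; left; right.
  have hz : R m z by apply: h; right.
  case: Am => [[E|E]|E]; rewrite E in hx hy hz.
  - have E' := Ranti _ _ zx hz; rewrite E' in yz; by move: yz; rewrite /lt hy.
  - by move: xy; rewrite /lt hx.
  - by move: yz; rewrite /lt hy.
have lt_min (A : set lex) : A !=set0 -> exists m, A m /\ forall x, A x -> ~ lt x m.
  by move=> /min[m [Am h]]; exists m; split=> // x /h; rewrite /lt => ->.
have [D [Dunc Dseg]] : exists D : set lex, ~ countable D /\
    forall w, D w -> countable [set v | D v /\ lt v w]%classic.
  have [h|nh] := pselect (exists w, ~ countable [set v | lt v w]%classic).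
    have [m [mu h']] := lt_min [set w | ~ countable [set v | lt v w]]%classic h.
    exists [set v | lt v m]%classic; split=> // w wm; apply: contrapT => nc.
    apply: (h' w) => // cw; apply: nc; apply: sub_countable cw.
    by apply: subset_card_le => v [].
  exists setT; split=> [|w _]; first exact: lex_uncountable.
  apply: contrapT => nc; apply: nh; exists w => cw; apply: nc.
  by apply: sub_countable cw; apply: subset_card_le => v [].
pose W := {x : lex | `[< D x >]}.
have DW (w : W) : D (val w) by apply/asboolP; exact: (valP w).
exists W, (fun v w : W => lt (val v) (val w)); split.
- move=> w; apply: contrapT => nacc.
  have [|_ [[m nm <-] hm]] := lt_min [set val v | v in [set v : W | ~ Acc (fun v w : W => lt (val v) (val w)) v]]%classic.
    by exists (val w); exists w.
  apply: nm; constructor => v vm; apply: contrapT => nv.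
  by apply: (hm (val v)) => //; exists v.
- by move=> u v w; exact: trans.
- move=> v w; case: (tri (val v) (val w)) => [h|/val_inj h|h];
    by [constructor 1|constructor 2|constructor 3].
- by move=> w; rewrite /lt Rxx.
- move=> w; have /countable_injP[f finj] := Dseg _ (DW w); apply/countable_injP.
  exists (fun v => f (val v)) => u v; rewrite !inE => uw vw E; apply: val_inj.
  by apply: finj E; rewrite inE; split.
- move=> /countable_injP[g ginj]; apply: Dunc; apply/countable_injP.
  exists (fun x => if insub x is Some w then g (w : W) else 0%N) => x y.
  rewrite !inE => Dx Dy; have px : `[< D x >] by apply/asboolP.
  have py : `[< D y >] by apply/asboolP.
  rewrite !insubT => E.
  by have [] := ginj (Sub x px) (Sub y py) (mem_set I) (mem_set I) E.
Qed.

(** * Inclusion of subsets of nat up to finite sets *)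

Section AlmostInclusion.
Implicit Types (a b c : lex) (i j k n N : nat).

Definition almost_sub a b := exists N, forall i, (N <= i)%N -> a i -> b i.

Definition infinite_diff a b := forall N, exists i, [/\ (N <= i)%N, a i & ~~ b i].

Lemma almost_sub_refl a : almost_sub a a. Proof. by exists 0. Qed.

Lemma almost_sub_trans b a c : almost_sub a b -> almost_sub b c -> almost_sub a c.
Proof.
move=> [N h] [M h']; exists (maxn N M) => i; rewrite geq_max => /andP[Ni Mi] ai.
by apply: h' => //; exact: h.
Qed.

Lemma eventually_all (P : nat -> nat -> Prop) :
  (forall j, exists N, forall i, (N <= i)%N -> P j i) ->
  forall k, exists N, forall i, (N <= i)%N -> forall j, (j <= k)%N -> P j i.
Proof.
move=> h; elim=> [|k [N hN]].
  by have [N hN] := h 0; exists N => i Ni j; rewrite leqn0 => /eqP ->; exact: hN.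
have [M hM] := h k.+1; exists (maxn N M) => i; rewrite geq_max => /andP[Ni Mi] j.
by rewrite leq_eqVlt => /orP[/eqP ->|]; [exact: hM|exact: hN].
Qed.

Lemma interpolate (a b : nat -> lex) : (forall j k, almost_sub (a j) (b k)) ->
  exists c, forall k, almost_sub (a k) c /\ almost_sub c (b k).
Proof.
move=> ab.
(* Each a k is cut down by finitely many b j, which costs it finitely many points. *)
exists (fun i => `[< exists k, a k i /\ forall j, (j <= k)%N -> b j i >]) => k; split.
  have [N hN] := eventually_all (fun j => ab k j) k.
  by exists N => i Ni ai; apply/asboolP; exists k; split=> // j jk; exact: hN.
have [N hN] := eventually_all (fun j => ab j k) k.
exists N => i Ni /asboolP[j [aj bj]]; have [kj|/ltnW jk] := leqP k j.
  exact: bj.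
exact: hN jk aj.
Qed.

(** The even and the odd terms of an increasing diagonal sequence. *)
Lemma pseudo_intersections (x : nat -> nat -> Prop) :
  (forall k N, exists i, (N <= i)%N /\ forall j, (j <= k)%N -> x j i) ->
  exists d0 d1 : lex, [/\ forall N, exists i, (N <= i)%N /\ d0 i,
    forall N, exists i, (N <= i)%N /\ d1 i, forall i, d0 i -> ~~ d1 i &
    forall j, exists N, forall i, (N <= i)%N -> d0 i || d1 i -> x j i].
Proof.
move=> h; have /choice[F hF] : forall p : nat * nat, exists i,
    (p.2 <= i)%N /\ forall j, (j <= p.1)%N -> x j i by move=> [k N]; exact: h.
pose d := fix d n := if n is m.+1 then F (m.+1, (d m).+1) else F (0, 0).
have dS n : (d n < d n.+1)%N by have [] := hF (n.+1, (d n).+1).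
have dx n j : (j <= n)%N -> x j (d n).
  by case: n => [|n] jn; [have [_ h'] := hF (0, 0)|have [_ h'] := hF (n.+1, (d n).+1)];
    exact: h'.
have dmono m n : (m < n)%N -> (d m < d n)%N.
  elim: n => // n IH; rewrite ltnS leq_eqVlt => /orP[/eqP -> //|/IH lt].
  exact: ltn_trans (dS n).
have dge n : (n <= d n)%N.
  by elim: n => // n IH; exact: leq_ltn_trans (dS n).
have dinj m n : d m = d n -> m = n.
  by move=> E; have [/dmono|/dmono|//] := ltngtP m n; rewrite E ltnn.
pose D (b : bool) : lex := fun i => `[< exists n, d (n.*2 + b) = i >].
exists (D false), (D true); split.
- move=> N; exists (d N.*2); split; last by apply/asboolP; exists N; rewrite addn0.
  by apply: leq_trans (dge _); rewrite -addnn leq_addr.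
- move=> N; exists (d (N.*2 + 1)); split; last by apply/asboolP; exists N.
  by apply: leq_trans (dge _); rewrite -addnn -addnA leq_addr.
- move=> i /asboolP[n <-]; apply/asboolP => -[m /dinj /(congr1 odd)].
  by rewrite !oddD !odd_double.
- move=> j; exists (d j) => i ji; have dd (b : bool) : D b i -> x j i.
    move=> /asboolP[n E]; rewrite -E in ji *; apply: dx.
    by rewrite leqNgt; apply/negP => /dmono; rewrite ltnNge ji.
  by move=> /orP[]; exact: dd.
Qed.

End AlmostInclusion.

Section HausdorffGap.
Variables (W : eqType) (lt : W -> W -> Prop).
Hypothesis W1 : omega1_like lt.
Implicit Types (u v w : W) (f : W -> lex * lex) (x : lex * lex).

(* Hausdorff's condition: for each n, only finitely many earlier lower sets
   are contained in the new upper set above n. *)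
Definition gap_spec f w x := [/\
  forall v, lt v w -> [/\ almost_sub (f v).1 x.1, infinite_diff x.1 (f v).1 &
    almost_sub x.2 (f v).2],
  almost_sub x.1 x.2, infinite_diff x.2 x.1 &
  forall n, exists l : seq W, forall v, lt v w ->
    (forall i, (f v).1 i -> ~~ x.2 i -> (i < n)%N) -> v \in l].

Lemma gap_local f g w x : (forall v, lt v w -> f v = g v) ->
  gap_spec f w x -> gap_spec g w x.
Proof.
move=> fg [h1 h2 h3 h4]; split=> // [v vw|n]; first by rewrite -fg //; exact: h1.
by have [l hl] := h4 n; exists l => v vw; rewrite -fg //; exact: hl.
Qed.

Lemma gap_step f w : (forall v, lt v w -> gap_spec f v (f v)) ->
  exists x, gap_spec f w x.
Proof.
move=> fgap; have [lt_wf ltT lt_tri lt_irr lt_seg _] := W1.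
have [[v0 v0w]|nov] := pselect (exists v, lt v w); last first.
  exists (fun=> false, fun=> true); split=> /=.
  - by move=> v vw; case: nov; exists v.
  - by exists 0.
  - by move=> N; exists N.
  - by move=> n; exists [::] => v vw; case: nov; exists v.
have [g [gw gonto]] : exists g : nat -> W, (forall n, lt (g n) w) /\
    forall v, lt v w -> exists n, g n = v.
  have /countable_injP[q qinj] := lt_seg w.
  have /choice[g hg] : forall n, exists u, lt u w /\
      forall v, lt v w -> q v = n -> v = u.
    move=> n; have [[u [uw qu]]|nu] := pselect (exists u, lt u w /\ q u = n).
      by exists u; split=> // v vw qv; apply: qinj; rewrite ?inE // qv.
    by exists v0; split=> // v vw qv; case: nu; exists v.
  exists g; split=> [n|v vw]; first by have [] := hg n.
  by exists (q v); have [_ h] := hg (q v); rewrite -(h v vw erefl).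
pose le u v := lt u v \/ u = v.
have le_refl u : le u u by right.
have le_trans u v t : le u v -> le v t -> le u t.
  by move=> uv [vt|<-//]; left; case: uv => [uv|->//]; exact: (ltT _ v).
have nle u v : ~ le u v -> lt v u.
  by move=> h; case: (lt_tri u v) => // h'; case: h; [left|right].
(* A nondecreasing sequence cofinal below w. *)
pose y := fix y k := if k is m.+1 then
  (if `[< lt (y m) (g m.+1) >] then g m.+1 else y m) else g 0.
have yw k : lt (y k) w.
  by elim: k => [|k IH] /=; [exact: gw|case: asboolP => _ //; exact: gw].
have ymono j k : (j <= k)%N -> le (y j) (y k).
  move=> /subnK <-; elim: (k - j)%N => // n IH; rewrite addSn; apply: le_trans IH _.
  by rewrite /=; case: asboolP => h; [left|right].
have gy k : le (g k) (y k).
  case: k => [|k]; first exact: le_refl.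
  by rewrite /=; case: asboolP => h; [right|apply: contrapT => /nle].
have ycof v : lt v w -> exists k, le v (y k).
  by move=> /gonto[k <-]; exists k.
pose A v := (f v).1; pose B v := (f v).2.
have AA u v : lt v w -> le u v -> almost_sub (A u) (A v).
  move=> vw [uv|->]; last exact: almost_sub_refl.
  by have [h _ _ _] := fgap v vw; have [] := h u uv.
have BB u v : lt v w -> le u v -> almost_sub (B v) (B u).
  move=> vw [uv|->]; last exact: almost_sub_refl.
  by have [h _ _ _] := fgap v vw; have [] := h u uv.
have AvB v : lt v w -> almost_sub (A v) (B v).
  by move=> vw; have [_ h _ _] := fgap v vw.
have AB u v : lt u w -> lt v w -> almost_sub (A u) (B v).
  move=> uw vw; have [uv|/nle vu] := pselect (le u v).
    exact: almost_sub_trans (AA u v vw uv) (AvB v vw).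
  by apply: almost_sub_trans (AvB u uw) (BB v u uw _); left.
(* Room inside the gap: d0 goes into both new sets and d1 only into the upper one, up to finitely
   many points, which keeps the differences infinite. *)
have [|d0 [d1 [d0inf d1inf d01 dX]]] := @pseudo_intersections
    (fun k i => B (y k) i && ~~ A (y k) i).
  move=> k N; have [_ _ inf _] := fgap _ (yw k).
  have ev j : exists N, forall i, (N <= i)%N -> (j <= k)%N ->
      (A (y j) i -> A (y k) i) /\ (B (y k) i -> B (y j) i).
    have [jk|kj] := leqP j k; last by exists 0.
    have [N1 h1] := AA _ _ (yw k) (ymono j k jk).
    have [N2 h2] := BB _ _ (yw k) (ymono j k jk).
    exists (maxn N1 N2) => i; rewrite geq_max => /andP[Ni1 Ni2] _.
    by split; [exact: h1|exact: h2].
  have [M hM] := eventually_all ev k; have [i [Mi Bi Ai]] := inf (maxn N M).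
  move: Mi; rewrite geq_max => /andP[Ni Mi]; exists i; split=> // j jk.
  have [hA hB] := hM i Mi j jk jk; apply/andP; split; first exact: hB.
  by apply: contra Ai; exact: hA.
pose D i := d0 i || d1 i.
have DAB v : lt v w -> exists N, forall i, (N <= i)%N -> D i -> B v i && ~~ A v i.
  move=> vw; have [k vk] := ycof v vw; have [N hN] := dX k.
  have [N1 h1] := AA _ _ (yw k) vk; have [N2 h2] := BB _ _ (yw k) vk.
  exists (maxn N (maxn N1 N2)) => i; rewrite !geq_max => /and3P[Ni N1i N2i] Di.
  have /andP[Bi Ai] := hN i Ni Di; apply/andP; split; first exact: h2.
  by apply: contra Ai; exact: h1.
have [|b0 hb0] := @interpolate (fun k i => A (g k) i || D i) (fun k => B (g k)).
  move=> j k; have [N1 h1] := AB _ _ (gw j) (gw k); have [N2 h2] := DAB _ (gw k).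
  exists (maxn N1 N2) => i; rewrite geq_max => /andP[N1i N2i] /orP[|].
    exact: h1.
  by move=> /(h2 i N2i)/andP[].
have Ab0 v : lt v w -> almost_sub (A v) b0.
  move=> /gonto[k <-]; have [[N h] _] := hb0 k; exists N => i Ni Ai.
  by apply: h => //; rewrite Ai.
have b0B v : lt v w -> almost_sub b0 (B v) by move=> /gonto[k <-]; have [] := hb0 k.
have Db0 : almost_sub D b0.
  by have [[N h] _] := hb0 0; exists N => i Ni Di; apply: h => //; rewrite Di orbT.
(* The v that are dangerous for b0 at n. Below y k there are finitely many, by Hausdorff's condition
   at y k, because b0 is almost contained in B (y k). *)
pose Z n v := forall i, A v i -> ~~ b0 i -> (i < n)%N.
have /choice[Zl hZl] : forall p : nat * nat, exists l : seq W, forall v,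
    le v (y p.2) -> Z p.1 v -> v \in l.
  move=> [n k] /=; have [N hN] := b0B _ (yw k); have [_ _ _ h] := fgap _ (yw k).
  have [l hl] := h (maxn n N); exists (y k :: l) => v [vk|->] Zv; last exact: mem_head.
  rewrite inE hl ?orbT // => i Ai Bi; rewrite leq_max; have [Ni|//] := leqP N i.
    by rewrite Zv //; apply: contra Bi; exact: hN.
  by rewrite orbT.
(* The point of A v to be removed. It avoids A (y j) for all j up to k, so that each A (y j) loses
   only finitely many points. *)
have /choice[m hm] : forall p : nat * W, exists i, lt p.2 w -> lt (y p.1) p.2 ->
    [/\ (p.1 <= i)%N, A p.2 i, ~~ D i & forall j, (j <= p.1)%N -> ~~ A (y j) i].
  move=> [k v] /=; have [[vw kv]|h] := pselect (lt v w /\ lt (y k) v); last first.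
    by exists 0 => vw kv; case: h.
  have [N hN] := DAB v vw; have [h _ _ _] := fgap v vw; have [_ inf _] := h _ kv.
  have ev j : exists N, forall i, (N <= i)%N -> (j <= k)%N ->
      A (y j) i -> A (y k) i.
    have [jk|kj] := leqP j k; last by exists 0.
    by have [N1 h1] := AA _ _ (yw k) (ymono j k jk); exists N1 => i Ni _; exact: h1.
  have [M hM] := eventually_all ev k.
  have [i [Mi Ai nAi]] := inf (maxn k (maxn N M)); exists i => _ _.
  move: Mi; rewrite !geq_max => /and3P[ki Ni Mi]; split=> // [|j jk].
    by apply/negP => /(hN i Ni)/andP[_]; rewrite /A Ai.
  by apply: contra nAi; exact: hM.
(* Removing from b0 one point of A v for each dangerous v restores Hausdorff's
   condition, and keeps b above each A v up to a finite set. *)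
pose C i := exists k v, [/\ lt v w, lt (y k) v, le v (y k.+1), Z k v & m (k, v) = i].
pose b : lex := fun i => b0 i && `[< ~ C i >].
have bb0 i : b i -> b0 i by case/andP.
have Cy j : exists N, forall i, (N <= i)%N -> C i -> ~~ A (y j) i.
  have bound k : exists N, forall i, (N <= i)%N -> forall v,
      lt v w -> lt (y k) v -> le v (y k.+1) -> Z k v -> m (k, v) != i.
    exists (\max_(v <- Zl (k, k.+1)) m (k, v)).+1 => i Ni v vw kv vk Zv.
    apply/eqP => E; move: Ni; rewrite ltnNge -E => /negP; apply.
    by apply: (@leq_bigmax_seq _ _ _ (fun v => m (k, v))) => //; exact: hZl.
  have [N hN] := eventually_all bound j; exists N => i Ni [k [v [vw kv vk Zv E]]].
  have [jk|kj] := leqP j k.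
    by have [_ _ _ h] := hm (k, v) vw kv; rewrite -E; exact: h.
  by have /negP := hN i Ni k (ltnW kj) v vw kv vk Zv; rewrite E.
have Ab v : lt v w -> almost_sub (A v) b.
  move=> vw; have [k vk] := ycof v vw; have [N hN] := Cy k.
  have [N1 h1] := AA _ _ (yw k) vk; have [N2 h2] := Ab0 v vw.
  exists (maxn N (maxn N1 N2)) => i; rewrite !geq_max => /and3P[Ni N1i N2i] Ai.
  apply/andP; split; first exact: h2.
  by apply/asboolP => /(hN i Ni); rewrite h1.
have Db : almost_sub D b.
  have [N h] := Db0; exists N => i Ni Di; apply/andP; split; first exact: h.
  apply/asboolP => -[k [v [vw kv _ _ E]]]; have [_ _ h' _] := hm (k, v) vw kv.
  by rewrite E Di in h'.
pose a : lex := fun i => b i && ~~ d1 i.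
exists (a, b); split=> /=.
- move=> v vw; have [N hN] := DAB v vw; split.
  + have [N1 h1] := Ab v vw; exists (maxn N N1) => i.
    rewrite geq_max => /andP[Ni N1i] Ai; rewrite /a h1 //=; apply/negP => d1i.
    by have := hN i Ni; rewrite /D d1i orbT => /(_ isT)/andP[_]; rewrite /A Ai.
  + move=> M; have [N1 h1] := Db; have [i [Mi d0i]] := d0inf (maxn M (maxn N N1)).
    move: Mi; rewrite !geq_max => /and3P[Mi Ni N1i]; exists i; split=> //.
      by rewrite /a h1 ?d01 // /D d0i.
    by have := hN i Ni; rewrite /D d0i => /(_ isT)/andP[].
  + have [N1 h1] := b0B v vw; exists N1 => i Ni /bb0; exact: h1.
- by exists 0 => i _ /andP[].
- move=> M; have [N1 h1] := Db; have [i [Mi d1i]] := d1inf (maxn M N1).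
  move: Mi; rewrite !geq_max => /andP[Mi N1i]; exists i; split=> //.
    by rewrite h1 // /D d1i orbT.
  by rewrite /a d1i andbF.
- move=> n; exists (Zl (n, n)) => v vw hv.
  have Zv : Z n v by move=> i Ai nb0; apply: hv => //; apply: contra nb0; exact: bb0.
  apply: (hZl (n, n)) => //=; apply: contrapT => /nle nv.
  (* The step at which v was treated. Since v is above y n, it comes at n or later, and the point
     removed then contradicts [hv]. *)
  have [k [nk kv vk]] : exists k, [/\ (n <= k)%N, lt (y k) v & le v (y k.+1)].
    have ex : exists k, `[< le v (y k) >].
      by have [k vk] := ycof v vw; exists k; apply/asboolP.
    have [k /asboolP vk mink] := ex_minnP ex.
    have nk : (n < k)%N.
      rewrite ltnNge; apply/negP => kn; apply: (lt_irr v).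
      by have [vn|E] := le_trans _ _ _ vk (ymono k n kn); [exact: (ltT _ (y n))|rewrite {1}E].
    case: k nk vk mink => // k nk vk mink; exists k; split=> //; apply: nle => vk'.
    by have := mink k; rewrite ltnn => /(_ (asboolT vk')).
  have [ki Ai _ _] := hm (k, v) vw kv.
  have Zk : Z k v by move=> i Ai' bi; apply: leq_trans nk; exact: Zv.
  have : (m (k, v) < n)%N.
    apply: hv => //; apply/negP => /andP[_ /asboolP]; apply.
    by exists k, v.
  by rewrite ltnNge (leq_trans nk ki).
Qed.

Lemma hausdorff_gap : exists f : W -> lex * lex, forall w, gap_spec f w (f w).
Proof.
have [lt_wf _ _ _ _ _] := W1.
apply: (transfinite_recursion (lex_zero, lex_zero) lt_wf); first exact: gap_local.
exact: gap_step.
Qed.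

End HausdorffGap.

(** * The lower halves of the gap form a lambda'-set *)

Section GapSet.
Variables (W : eqType) (lt : W -> W -> Prop).
Hypothesis W1 : omega1_like lt.
Variable f : W -> lex * lex.
Hypothesis fgap : forall w, gap_spec lt f w (f w).
Implicit Types (u v w : W) (p q h : lex) (i j k n : nat).

Let lower w := (f w).1.
Let upper w := (f w).2.

(** The least point is added because complements have it in their representation ([parC]). *)
Definition gap_points p := p = lex_zero \/ exists w, p = (f w).1.

Lemma lower_lt v w : lt v w -> almost_sub (lower v) (lower w).
Proof. by move=> vw; have [h _ _ _] := fgap w; have [] := h v vw. Qed.

Lemma upper_lt v w : lt v w -> almost_sub (upper w) (upper v).
Proof. by move=> vw; have [h _ _ _] := fgap w; have [] := h v vw. Qed.

Lemma lower_upper w : almost_sub (lower w) (upper w).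
Proof. by have [] := fgap w. Qed.

Lemma lower_inj : injective lower.
Proof.
move=> v w; have H u t : lt u t -> lower u <> lower t.
  move=> ut E; have [h _ _ _] := fgap t; have [_ inf _] := h u ut.
  by have [i [_]] := inf 0; rewrite -/(lower t) -/(lower u) E => ->.
by have [/H|//|/H nE] := omega1_tri W1 v w => // /esym.
Qed.

Lemma omega1_bounded (T : Type) (P : set T) (g : T -> W) : countable P ->
  exists w, forall t, P t -> lt (g t) w.
Proof.
move=> cP; apply: contrapT => nw; apply: (omega1_uncountable W1).
have cU : countable (\bigcup_(t in P) ([set v | lt v (g t)] `|` [set g t])).
  apply: bigcup_countable => // t _; rewrite -bigcup2E.
  apply: bigcup_countable => // -[|[|i]] _ //=.
  exact: omega1_seg W1 (g t).
apply: sub_countable cU; apply: subset_card_le => w _.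
apply: contrapT => nU; apply: nw; exists w => t Pt.
by case: (omega1_tri W1 (g t) w) => // h; case: nU; exists t => //; [right|left].
Qed.

(* A set interpolated in the gap would make uncountably many lower sets
   agree with it above a common n, contradicting Hausdorff's condition. *)
Lemma gap_unfilled p : exists w, ~ (almost_sub (lower w) p /\ almost_sub p (upper w)).
Proof.
apply: contrapT => H.
have {}H w : exists n, forall i, (n <= i)%N -> (lower w i -> p i) /\ (p i -> upper w i).
  have [[n1 h1] [n2 h2]] : almost_sub (lower w) p /\ almost_sub p (upper w).
    by apply: contrapT => h; apply: H; exists w.
  exists (maxn n1 n2) => i; rewrite geq_max => /andP[n1i n2i].
  by split; [exact: h1|exact: h2].
have /choice[g hg] := H; apply: (omega1_uncountable W1).
pose Wn n := [set w | g w = n].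
have -> : [set: W] = \bigcup_(n in [set: nat]) Wn n.
  by apply/seteqP; split=> // w _; exists (g w).
apply: bigcup_countable => // n _.
(* The predecessors of w inside [Wn n], finitely many by Hausdorff's condition; their number is
   strictly increasing on [Wn n] and so enumerates it. *)
have /choice[l hl] : forall w, exists l : seq W, uniq l /\
    forall v, v \in l <-> lt v w /\ Wn n v /\ Wn n w.
  move=> w; have [_ _ _ /(_ n)[l hl]] := fgap w.
  exists (undup [seq v <- l | `[< lt v w /\ Wn n v /\ Wn n w >]]).
  split=> [|v]; first exact: undup_uniq.
  rewrite mem_undup mem_filter; split=> [/andP[/asboolP]//|h].
  apply/andP; split; first exact/asboolP.
  have [vw [gv gw]] := h; apply: hl => // i lvi nui; rewrite ltnNge; apply/negP => ni.
  have [h1 _] : (lower v i -> p i) /\ (p i -> upper v i) by apply: hg; rewrite gv.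
  have [_ h2] : (lower w i -> p i) /\ (p i -> upper w i) by apply: hg; rewrite gw.
  by move: nui; rewrite -/(upper w) h2 ?h1.
apply/countable_injP; exists (fun w => size (l w)) => v w.
rewrite !in_setE => nv nw.
have S u t : Wn n u -> Wn n t -> lt u t -> (size (l u) < size (l t))%N.
  move=> nu nt ut; apply: (@uniq_leq_size _ (u :: l u)).
    rewrite /= (proj1 (hl u)) andbT; apply/negP => /(proj2 (hl u) u)[uu _].
    exact: omega1_irr W1 u uu.
  move=> t'; rewrite inE => /orP[/eqP ->|]; first by apply/(proj2 (hl t)).
  move=> /(proj2 (hl u))[t'u [nt' _]]; apply/(proj2 (hl t)); split=> //.
  exact: omega1_trans W1 _ _ _ t'u ut.
case: (omega1_tri W1 v w) => // vw E;
  [have := S v w nv nw vw|have := S w v nw nv vw]; by rewrite E ltnn.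
Qed.

Lemma gap_segment w : exists q : nat -> lex,
  forall p, p = lex_zero \/ (exists2 v, lt v w & p = lower v) -> exists n, q n = p.
Proof.
have /countable_injP[g ginj] := omega1_seg W1 w.
have /choice[q hq] : forall n, exists p, forall v, lt v w -> g v = n -> lower v = p.
  move=> n; have [[v [vw gv]]|h] := pselect (exists v, lt v w /\ g v = n).
    exists (lower v) => u uw gu; congr lower; apply: ginj; rewrite ?in_setE //.
    by rewrite gu.
  by exists lex_zero => v vw gv; case: h; exists v.
exists (fun n => if n is m.+1 then q m else lex_zero) => p [->|[v vw ->]].
  by exists 0.
by exists (g v).+1; rewrite (hq (g v) v).
Qed.

Lemma gap_lambda_prime : lambda_prime gap_points.
Proof.
move=> P cP; have /choice[g hg] := gap_unfilled.
have [w hw] := omega1_bounded g cP; have [q hq] := gap_segment w.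
pose F n (z : lex) := forall i, (n <= i)%N -> (lower w i -> z i) /\ (z i -> upper w i).
have FP n z : F n z -> ~ P z.
  move=> Fz Pz; apply: (hg z); split.
    apply: almost_sub_trans (lower_lt (hw z Pz)) _.
    by exists n => i ni; have [] := Fz i ni.
  apply: almost_sub_trans (upper_lt (hw z Pz)).
  by exists n => i ni; have [] := Fz i ni.
have Fcl n h : ~ F n h -> exists k, forall z, trunc k z = trunc k h -> ~ F n z.
  move=> /existsNP[i /not_implyP[ni nFi]]; exists i.+1 => z /truncP E Fz.
  by apply: nFi; rewrite -(E i (ltnSn i)); exact: Fz.
(* The sets F n cover the lower halves from w on; the countably many remaining points are added as
   singletons. *)
exists (fun n (z : lex) => F n z \/ (z = q n /\ ~ P z)); split.
- move=> n h /not_orP[nF /not_andP nq]; have [k hk] := Fcl n h nF.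
  have [E|hq'] := eqVneq h (q n).
    exists k => z zk [Fz|[zq Pz]]; first exact: hk Fz.
    by case: nq => // nP; apply: nP; rewrite E -zq.
  have [k' hk'] := trunc_sep hq'; exists (maxn k k') => z zk [Fz|[zq _]].
    by apply: (hk z) Fz; exact: trunc_leq (leq_maxl k k') zk.
  by have := hk' _ (leq_maxr k k'); rewrite -zk zq eqxx.
- by move=> n z [/FP|[]].
- move=> l Ll nPl.
  have old : l = lex_zero \/ (exists2 v, lt v w & l = lower v) ->
      exists n, F n l \/ (l = q n /\ ~ P l).
    by move=> /hq[n E]; exists n; right; rewrite E.
  case: Ll => [l0|[v lv]]; first by apply: old; left.
  case: (omega1_tri W1 v w) => h; first by apply: old; right; exists v.
    have [n hn] := lower_upper w; exists n; left; rewrite lv h => i ni; split=> //.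
    exact: hn.
  have [n1 h1] := lower_lt h; have [n2 h2] := upper_lt h.
  have [n3 h3] := lower_upper v.
  exists (maxn n1 (maxn n2 n3)); left => i; rewrite !geq_max lv => /and3P[i1 i2 i3].
  by split=> hi; [exact: h1|apply: h2 => //; exact: h3].
Qed.

End GapSet.

(** * The interval algebra of L and its subalgebras *)

Section IntervalSets.
Variable L : lex -> Prop.
Hypothesis L0 : L lex_zero.
Implicit Types a b : bset lex.

Definition interval_set a := exists2 F, a = par F & {in F, forall y, L y}.

Definition interval_pred : {pred bset lex} := fun a => `[< interval_set a >].

Lemma interval_set_fin a : interval_set a -> fin_set a.
Proof. by move=> [F -> _]; exists F. Qed.

Lemma interval_set_bd a : interval_set a -> {in bd a, forall y, L y}.
Proof. by move=> [F E LF]; exact: bd_sub E LF. Qed.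

Lemma interval_setE a : fin_set a -> {in bd a, forall y, L y} -> interval_set a.
Proof. by move=> fa La; exists (bd a); rewrite ?par_bd. Qed.

Lemma interval_set_field : is_field interval_set.
Proof.
split.
- by exists [::].
- move=> a [F -> LF]; rewrite parC; exists (lex_zero :: F) => // y.
  by rewrite inE => /orP[/eqP ->|/LF].
- move=> a b ia ib; have fa := interval_set_fin ia; have fb := interval_set_fin ib.
  apply: interval_setE => [|y]; first exact: fin_setI.
  by move=> /(bdI_sub fa fb)[|]; exact: interval_set_bd.
Qed.

Fact interval_pred0 : \bot%O \in interval_pred.
Proof. by apply/asboolP; have [] := interval_set_field. Qed.

Fact interval_pred1 : \top%O \in interval_pred.
Proof. by apply/asboolP; exact: fieldT interval_set_field. Qed.

Fact interval_predI :
  {in interval_pred &, forall a b, (a `&` b)%O \in interval_pred}.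
Proof.
move=> a b /asboolP ia /asboolP ib; apply/asboolP.
by have [_ _ h] := interval_set_field; exact: h.
Qed.

Fact interval_predU :
  {in interval_pred &, forall a b, (a `|` b)%O \in interval_pred}.
Proof.
move=> a b /asboolP ia /asboolP ib; apply/asboolP.
exact: fieldU interval_set_field ia ib.
Qed.

Fact interval_predC : {in interval_pred, forall a, (~` a)%O \in interval_pred}.
Proof.
move=> a /asboolP ia; apply/asboolP.
by have [_ h _] := interval_set_field; exact: h.
Qed.

Definition interval_sets : subalgebra (bset lex) :=
  Subalgebra interval_pred0 interval_pred1 interval_predI interval_predU
    interval_predC.

(** Stated for an embedding f so as to cover both the algebra itself and its subalgebras, which are
    different types. *)
Lemma interval_sets_hereditary d (A : ctbDistrLatticeType d) (f : A -> bset lex) :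
  lambda_prime L -> injective f ->
  (forall x y, f (x `&` y)%O = bsetI (f x) (f y)) ->
  (forall x, f (~` x)%O = bsetC (f x)) ->
  (forall x, interval_set (f x)) -> is_interval_algebra A.
Proof.
move=> lamL finj fI fC fL; pose S a := exists x, f x = a.
have fS : is_field S.
  split.
  - exists \bot%O; rewrite -(meetxC \bot%O) fI fC; apply: bsetP => z.
    by rewrite /bsetI /bsetC andbN.
  - by move=> _ [x <-]; exists (~` x)%O.
  - by move=> _ _ [x <-] [y <-]; exists (x `&` y)%O.
have SL a : S a -> interval_set a by move=> [x <-].
have [|a Sa|C [hC CS SC]] := subalgebra_chain lamL fS.
- by move=> a /SL/interval_set_fin.
- exact/interval_set_bd/SL.
- by apply: (chain_interval_algebra finj fI fC hC) => // x; apply: SC; exists x.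
Qed.

End IntervalSets.

(** * Cardinality aleph_1 *)

Section Cardinality.
Variables (W : eqType) (lt : W -> W -> Prop).
Hypothesis W1 : omega1_like lt.

(** A copy of W times nat, not only of W, leaves room for codes of finite sequences. *)
Lemma omega1_embedding U (C : set U) : ~ countable C ->
  exists h : W -> nat -> U, (forall w n, C (h w n)) /\
    forall v w m n, h v m = h w n -> v = w /\ m = n.
Proof.
move=> nC; have [u0 _] : C !=set0.
  by apply/set0P/negP => /eqP C0; apply: nC; rewrite C0.
pose R (f : W -> nat -> U) w (x : nat -> U) := [/\ forall n, C (x n), injective x &
  forall v, lt v w -> forall m n, f v m <> x n].
have [f g w x fg [h1 h2 h3]|f w _|f hf] :=
    @transfinite_recursion W lt (nat -> U) (fun=> u0) (omega1_wf W1) R.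
- by split=> // v vw m n; rewrite -fg //; exact: h3.
- pose Y := \bigcup_(v in [set v | lt v w]) range (f v).
  have cY : countable Y.
    apply: bigcup_countable => [|v _]; first exact: omega1_seg W1 w.
    exact: sub_countable (card_image_le _ _) _.
  have [|x [xinj xC]] := @infinite_injection U (C `\` Y).
    move=> /finite_set_countable cCY; apply: nC.
    have : countable (\bigcup_(i in [set: bool]) (if i then Y else C `\` Y)).
      by apply: bigcup_countable => // -[].
    apply: sub_countable; apply: subset_card_le => u Cu.
    by have [Yu|nYu] := pselect (Y u); [exists true|exists false].
  exists x; split=> // [n|v vw m n E]; first by have [] := xC n.
  by have [_] := xC n; apply; exists v => //; exists m.
- exists f; split=> [w n|v w m n E]; first by have [h _ _] := hf w.
  have H u t i j : lt u t -> f u i <> f t j.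
    by move=> ut; have [_ _ h] := hf t; exact: h.
  case: (omega1_tri W1 v w) => vw; first by case: (H v w m n vw).
    by rewrite vw in E *; have [_ inj _] := hf w; split=> //; exact: inj.
  by case: (H w v n m vw).
Qed.

End Cardinality.

Theorem theorem1p7 :
  exists (d : Order.disp_t) (B : ctbDistrLatticeType d),
    [/\ is_interval_algebra B, is_hereditary B
      & has_card_aleph1 (@setT B)].
Proof.
have [W [lt W1]] := omega1_exists; have [f fgap] := hausdorff_gap W1.
pose L := gap_points f; have L0 : L lex_zero by left.
have lamL : lambda_prime L := gap_lambda_prime W1 fgap.
pose B := subalgebra_type (interval_sets L0).
have BL (x : B) : interval_set L (val x).
  by apply/asboolP; exact: (subalgebra_valP x).
exists _, B; split.
- apply: (interval_sets_hereditary (f := fun x : B => subalgebra_val x) lamL).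
  + exact: val_inj.
  + move=> x y. rewrite subalgebra_valI. by [].
  + move=> x. rewrite subalgebra_valC. by [].
  + exact: BL.
- move=> S. apply: (interval_sets_hereditary
    (f := fun x : subalgebra_type S => subalgebra_val (subalgebra_val x)) lamL).
  + by move=> x y /val_inj/val_inj.
  + move=> x y. rewrite !subalgebra_valI. by [].
  + move=> x. rewrite !subalgebra_valC. by [].
  + by move=> x; exact: BL.
split.
- move=> /countable_injP[g ginj]; apply: (omega1_uncountable W1).
  (* Final segments with distinct endpoints are distinct, so W embeds in B. *)
  have Bw w : par [:: (f w).1] \in interval_pred L.
    by apply/asboolP; exists [:: (f w).1] => // y; rewrite inE => /eqP ->; right; exists w.
  apply/countable_injP; exists (fun w => g (@SubalgebraElt _ _ (interval_sets L0) _ (Bw w))) => v w _ _ E.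
  have [E'] := ginj _ _ (mem_set I) (mem_set I) E.
  apply: (lower_inj W1 fgap); have : (f v).1 \in bd (par [:: (f w).1]).
    by rewrite -E' mem_bd_par /= eqxx.
  by rewrite mem_bd_par /=; case: eqP.
- move=> U C /(omega1_embedding W1)[h [hC hinj]].
  have /choice[q hq] := gap_segment W1 f.
  (* The index r x bounds those of all boundary points of x; so x is coded by r x and a finite
     sequence of natural numbers, through the enumeration q (r x). *)
  have /choice[r hr] : forall x : B, exists w, forall p, p \in bd (val x) ->
      p = lex_zero \/ exists2 v, lt v w & p = (f v).1.
    move=> x.
    have /choice[g hg] : forall p, exists w, p \in bd (val x) ->
        p = lex_zero \/ p = (f w).1.
      have [w0 _] : [set: W] !=set0.
        by apply/set0P/negP => /eqP E; apply: (omega1_uncountable W1); rewrite E.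
      move=> p; have [pb|] := boolP (p \in bd (val x)); last by exists w0.
      by have [->|[w ->]] := interval_set_bd (BL x) pb; [exists w0; left|exists w; right].
    have cb : countable [set p | p \in bd (val x)].
      apply: finite_set_countable; exact: finite_seq.
    have [w hw] := omega1_bounded W1 g cb; exists w => p pb.
    by have [->|->] := hg p pb; [left|right; exists (g p) => //; exact: hw].
  have /choice[e he] : forall x : B, exists n, exists2 ns : seq nat,
      pickle ns = n & val x = par (map (q (r x)) ns).
    move=> x; suff [ns E] : exists ns, bd (val x) = map (q (r x)) ns.
      by exists (pickle ns), ns => //; rewrite -E par_bd //; exact: interval_set_fin (BL x).
    elim: (bd (val x)) (hr x) => [|p X IH] hX; first by exists [::].
    have [n <-] := hq (r x) p (hX p (mem_head _ _)).
    have [|ns ->] := IH; first by move=> p' pX; apply: hX; rewrite inE pX orbT.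
    by exists (n :: ns).
  have [j] : $|{injfun [set: B] >-> C}|.
    apply/injfunPex; exists (fun x => h (r x) (e x)) => [x _|x y _ _ /hinj[rxy exy]].
      exact: hC.
    have [ns nsx xE] := he x; have [ns' nsy yE] := he y; apply: val_inj.
    rewrite xE yE rxy; congr (par (map _ _)); apply: (pcan_inj pickleK).
    by rewrite nsx nsy.
  exact: inj_card_le.
Qed.
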